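(* Let $\Omega \subset \mathbb{R}^n$ be open, $k \in \mathbb{N}$, $1 \le p \le \infty$, and let $\alpha$ be a multi-index with $|\alpha| \le k$. The weak differential operator $D_\alpha : L^p(\Omega) \to L^p(\Omega)$ is a closed and $\mathscr{K}(\Omega)$-equivariant transformation on the Sobolev space $W^{k,p}(\Omega)$.
   Context: Smooth algebra: a smooth (smoothing) net is a family $(\phi_\varepsilon)_{\varepsilon>0}$ of functions on $\mathbb{R}^n$, each of which is non-negative, bounded, continuous, integrable, infinitely differentiable and compactly supported. The smooth algebra $\mathscr{K}(\Omega)$ is a collection of smoothing nets on $\Omega$ with the properties (i) $\phi_\varepsilon \in C^\infty_c(\mathbb{R}^n)$, (ii) $\mathrm{supp}(\phi_\varepsilon) \subset \overline{B}(0,\varepsilon)$, (iii) $\int \phi_\varepsilon(x)\,dx = 1$. For example, a smooth $\phi : \mathbb{R}^n \to [0,\infty)$ supported in the unit ball with $\int \phi = 1$ gives such a net by $\phi_\varepsilon(x) = \varepsilon^{-n}\phi(x/\varepsilon)$. Action: $\mathscr{K}(\Omega)$ acts on $L^p(\Omega)$ through its nets by convolution, $\phi_\varepsilon(f)(x) = f_\varepsilon(x) := \int_\Omega \phi_\varepsilon(x-y) f(y)\,dy$, which for $\phi_\varepsilon(x) = \varepsilon^{-n}\phi(x/\varepsilon)$ reads $\frac{1}{\varepsilon^n}\int_\Omega \phi\big(\frac{x-y}{\varepsilon}\big) f(y)\,dy$. Equivariance: $D_\alpha$ is $\mathscr{K}(\Omega)$-equivariant if it commutes with this action, i.e. $D_\alpha(\phi_\varepsilon(f))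 = \phi_\varepsilon(D_\alpha f)$. Weak derivative: for a multi-index $\alpha = (\alpha_1,\dots,\alpha_n)$, $\alpha_i \ge 0$, $|\alpha| = \sum_i \alpha_i$, and $\varphi \in C^{|\alpha|}(\Omega)$, put $D_\alpha\varphi = \partial^{|\alpha|}\varphi/\partial x_1^{\alpha_1}\cdots\partial x_n^{\alpha_n}$. A function $u \in L^1_{loc}(\Omega)$ is the $\alpha$-th weak derivative of $f$, written $u = D_\alpha f$, if $\int_\Omega \varphi u\,dx = (-1)^{|\alpha|}\int_\Omega f\,D_\alpha\varphi\,dx$ for all $\varphi \in C^\infty_c(\Omega)$; it is unique up to a set of measure zero. Sobolev space: $W^{k,p}(\Omega) = \{ f \in L^p(\Omega) : D_\alpha f \text{ exists and is in } L^p(\Omega) \text{ for all } |\alpha| \le k\}$.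
   Formalization: D_α is proved closed on its natural domain in L^p (which contains W^{k,p}), not with domain exactly W^{k,p}; and D_α(φ_ε f) = φ_ε(D_α f) is claimed only at x in Ω with x − supp φ_ε ⊂ Ω, since both fail as stated (α = 0, k ≥ 1; Ω = (0,1), f = 1, α = 1). *)

(* Defs.v *)
From HB Require Import structures.
From mathcomp Require Import all_boot all_order all_algebra.
From mathcomp Require Import all_classical all_reals all_analysis.

Set Implicit Arguments.
Unset Strict Implicit.
Unset Printing Implicit Defensive.
Import Order.TTheory GRing.Theory Num.Theory.
Import numFieldNormedType.Exports.

Local Open Scope classical_set_scope.
Local Open Scope ring_scope.

(** ** Lebesgue measure on R^n

   R^n is ['rV[R]_n], with the library's topology. As the library does for
   [n.-tuple T], it carries the sigma-algebra generated by the coordinates,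
   which is the Borel sigma-algebra. *)

Definition rV_display : measure_display. Proof. exact: default_measure_display. Qed.

Section measurable_rV.
Context {R : realType} {n : nat}.

Definition rV_coord (i : 'I_n) (x : 'rV[R]_n) : R := x ord0 i.

Let rV_set0 : g_sigma_preimage rV_coord set0.
Proof. exact: sigma_algebra0. Qed.

Let rV_setC A : g_sigma_preimage rV_coord A -> g_sigma_preimage rV_coord (~` A).
Proof. exact: sigma_algebraC. Qed.

Let rV_bigcup (F : (set 'rV[R]_n)^nat) :
  (forall i, g_sigma_preimage rV_coord (F i)) ->
  g_sigma_preimage rV_coord (\bigcup_i F i).
Proof. exact: sigma_algebra_bigcup. Qed.

HB.instance Definition _ := @isMeasurable.Build rV_display 'rV[R]_n
  (g_sigma_preimage rV_coord) rV_set0 rV_setC rV_bigcup.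

Lemma measurable_rV_coord (i : 'I_n) :
  measurable_fun [set: 'rV[R]_n] (rV_coord i).
Proof.
move=> _ Y mY; rewrite setTI; apply: sub_sigma_algebra => /=.
rewrite -bigcup_seq/=; exists i => /=; first by rewrite mem_index_enum.
by exists Y => //; rewrite setTI.
Qed.

Lemma measurable_fun_rVP d (T : measurableType d) (f : T -> 'rV[R]_n) :
  (forall i, measurable_fun setT (rV_coord i \o f)) -> measurable_fun setT f.
Proof.
move=> mc; suff H : g_sigma_preimage (fun i => rV_coord i \o f) `<=` measurable.
  move=> _ A mA; rewrite setTI; apply: H.
  by rewrite g_sigma_preimage_comp; exists A; rewrite ?setTI.
apply: smallest_sub; first exact: sigma_algebra_measurable.
rewrite -bigcup_seq; apply: bigcup_sub => i _ A [B mB <-]; exact: mc.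
Qed.

End measurable_rV.

Section rV_cons.
Context {R : realType} {n : nat}.

Definition rV_cons (tx : R * 'rV[R]_n) : 'rV[R]_n.+1 :=
  \row_i oapp (tx.2 ord0) tx.1 (unlift ord0 i).

Lemma rV_cons0 tx : rV_cons tx ord0 ord0 = tx.1.
Proof. by rewrite mxE unlift_none. Qed.

Lemma rV_consS tx i : rV_cons tx ord0 (lift ord0 i) = tx.2 ord0 i.
Proof. by rewrite mxE liftK. Qed.

Lemma measurable_rV_cons : measurable_fun setT rV_cons.
Proof.
apply: measurable_fun_rVP => i.
case: (unliftP ord0 i) => [j|] ->.
  rewrite (_ : _ \o _ = rV_coord j \o snd).
    by apply: measurableT_comp => //; exact: measurable_rV_coord.
  by apply/funext => tx /=; exact: rV_consS.
by rewrite (_ : _ \o _ = fst)//; apply/funext => tx /=; exact: rV_cons0.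
Qed.

Variable m : {sigma_finite_measure set 'rV[R]_n -> \bar R}.

Definition rV_cons_measure : set 'rV[R]_n.+1 -> \bar R :=
  pushforward (@lebesgue_measure R \x m)%E rV_cons.

Let mE : rV_cons_measure =
  pushforward (@lebesgue_measure R \x m)%E rV_cons.
Proof. by []. Qed.

Let rV_cons_measure0 : rV_cons_measure set0 = 0%E.
Proof. by rewrite mE /pushforward preimage_set0 measure0. Qed.

Let rV_cons_measure_ge0 A : (0 <= rV_cons_measure A)%E.
Proof. by rewrite mE /pushforward; apply: (measure_ge0 (lebesgue_measure \x m)%E). Qed.

Let mcons A : measurable A -> measurable (rV_cons @^-1` A).
Proof. by move=> mA; rewrite -[X in measurable X]setTI; exact: measurable_rV_cons. Qed.

Let rV_cons_measure_sigma_additive : semi_sigma_additive rV_cons_measure.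
Proof.
move=> F mF tF mUF; rewrite mE /pushforward preimage_bigcup.
apply: measure_semi_sigma_additive.
- by move=> i; exact: mcons.
- apply/trivIsetP => /= i j _ _ ij; rewrite -preimage_setI.
  by move/trivIsetP : tF => /(_ _ _ _ _ ij) ->//; rewrite preimage_set0.
- by rewrite -preimage_bigcup; exact: mcons.
Qed.

HB.instance Definition _ := isMeasure.Build _ _ _ rV_cons_measure
  rV_cons_measure0 rV_cons_measure_ge0 rV_cons_measure_sigma_additive.

Lemma rV_cons_measureX (A : set R) (B : set 'rV[R]_n) :
  measurable A -> measurable B ->
  rV_cons_measure [set x | A (x ord0 ord0) /\ B (\row_i x ord0 (lift ord0 i))] =
  (lebesgue_measure A * m B)%E.
Proof.
move=> mA mB; rewrite -product_measure1E// mE /pushforward; congr (product_measure1 _ _ _).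
have tl tx : \row_i rV_cons tx ord0 (lift ord0 i) = tx.2.
  by apply/rowP => i; rewrite mxE rV_consS.
by apply/seteqP; split => tx /=; rewrite rV_cons0 tl.
Qed.

Let rV_cons_measure_sigma_finite : sigma_finite setT rV_cons_measure.
Proof.
have /sigma_finiteP[F [TF ndF Foo]] := sigma_finiteT (@lebesgue_measure R).
have /sigma_finiteP[G [TG ndG Goo]] := sigma_finiteT m.
exists (fun k => [set x : 'rV[R]_n.+1 | F k (x ord0 ord0) /\
    G k (\row_i x ord0 (lift ord0 i))]).
  apply/seteqP; split => // x _.
  have : setT (x ord0 ord0) by [].
  rewrite TF => -[i _ Fi].
  have : setT (\row_i x ord0 (lift ord0 i)) by [].
  rewrite TG => -[j _ Gj]; exists (maxn i j) => //; split.
    by move: Fi; exact/subsetPset/ndF/leq_maxl.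
  by move: Gj; exact/subsetPset/ndG/leq_maxr.
move=> k; have [mF Fk] := Foo k; have [mG Gk] := Goo k; split; last first.
  by rewrite rV_cons_measureX// lte_mul_pinfty// ge0_fin_numE.
apply: measurableI; rewrite -[X in measurable X]setTI.
  exact: (measurable_rV_coord ord0).
have mtl : measurable_fun setT (fun x : 'rV[R]_n.+1 => \row_i x ord0 (lift ord0 i)).
  apply/measurable_fun_rVP => i.
  rewrite (_ : _ \o _ = rV_coord (lift ord0 i)); first exact: measurable_rV_coord.
  by apply/funext => x; rewrite /= /rV_coord mxE.
exact: mtl.
Qed.

HB.instance Definition _ := Measure_isSigmaFinite.Build _ _ _ rV_cons_measure
  rV_cons_measure_sigma_finite.

End rV_cons.

Fixpoint lebesgue_rV {R : realType} (n : nat) :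
    {sigma_finite_measure set 'rV[R]_n -> \bar R} :=
  match n with
  | 0 => \d_(0 : 'rV[R]_0)
  | n'.+1 => rV_cons_measure (lebesgue_rV n')
  end.

Lemma lebesgue_rV_box {R : realType} n (A : 'I_n -> set R) :
  (forall i, measurable (A i)) ->
  lebesgue_rV n [set x | forall i, A i (x ord0 i)] =
  (\prod_(i < n) lebesgue_measure (A i))%E.
Proof.
elim: n A => [|n IHn] A mA.
  by rewrite big_ord0 /= diracE mem_set// => -[].
rewrite big_ord_recl -IHn// -rV_cons_measureX//; last first.
  rewrite [X in measurable X](_ : _ =
      \bigcap_(i in [set: 'I_n]) (rV_coord i @^-1` A (lift ord0 i))); last first.
    by apply/seteqP; split => x Hx i; [move=> _|]; exact: Hx.
  apply: fin_bigcap_measurable => // i _; rewrite -[X in measurable X]setTI.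
  exact: measurable_rV_coord.
congr (rV_cons_measure _ _); apply/seteqP; split => x /=.
  by move=> Ax; split => // i; rewrite mxE.
by move=> [A0 AS] i; case: (unliftP ord0 i) => [j|] -> //; have := AS j; rewrite mxE.
Qed.

(** ** Smooth functions *)

Section smooth.
Context {R : realType} {n : nat}.
Implicit Types (f : 'rV[R]_n -> R) (alpha : 'I_n -> nat) (Omega : set 'rV[R]_n).

Definition partial (i : 'I_n) f : 'rV[R]_n -> R :=
  fun x => 'D_(delta_mx ord0 i) f x.

Fixpoint Ck (m : nat) f : Prop :=
  match m with
  | 0 => continuous f
  | m'.+1 => continuous f /\ forall i : 'I_n,
      (forall x, derivable f x (delta_mx ord0 i)) /\ Ck m' (partial i f)
  end.

Definition smooth f := forall m, Ck m f.

Definition midx_size alpha : nat := (\sum_(i < n) alpha i)%N.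

Definition partials alpha f : 'rV[R]_n -> R :=
  foldr (fun i g => iter (alpha i) (partial i) g) f (enum 'I_n).

Definition supp f : set 'rV[R]_n := closure [set x | f x != 0].

(* C^oo_c(Omega), each function being extended by 0 to R^n *)
Definition Cc_smooth Omega : set ('rV[R]_n -> R) :=
  [set f | [/\ smooth f, compact (supp f) & supp f `<=` Omega]].

(* the library's norm on ['rV[R]_n] is the sup norm *)
Definition eucl_cball (r : R) : set 'rV[R]_n :=
  [set x | Num.sqrt (\sum_(i < n) x ord0 i ^+ 2) <= r].

End smooth.

(** ** L^p(Omega), weak derivatives and Sobolev spaces

   A function on Omega is represented by a total function on R^n whose values
   outside Omega are ignored; [f \_ Omega] is its extension by 0. *)

Section sobolev.
Context {R : realType} {n : nat}.
Implicit Types (f g u : 'rV[R]_n -> R) (alpha : 'I_n -> nat).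
Implicit Types (Omega : set 'rV[R]_n) (p : \bar R).

Local Notation mu := (lebesgue_rV n : {measure set 'rV[R]_n -> \bar R}).

Definition Lp Omega p : set ('rV[R]_n -> R) :=
  [set f | (f \_ Omega) \in Lfun mu p].

Definition Lp_cvg Omega p (f_ : nat -> 'rV[R]_n -> R) f : Prop :=
  'N[mu]_p[EFin \o ((f_ j \- f)%R \_ Omega)]%E @[j --> \oo] --> 0%E.

Definition L1loc Omega : set ('rV[R]_n -> R) :=
  [set f | measurable_fun Omega f /\
    forall K, compact K -> K `<=` Omega -> mu.-integrable K (EFin \o f)].

Definition weak_deriv Omega alpha f u : Prop :=
  L1loc Omega u /\ forall phi, Cc_smooth Omega phi ->
    (\int[mu]_(x in Omega) (phi x * u x) =
     (-1) ^+ midx_size alpha * \int[mu]_(x in Omega) (f x * partials alpha phi x))%R.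

(* graph of D_alpha as an operator from L^p(Omega) to L^p(Omega), with domain
   all f in L^p(Omega) such that D_alpha f exists and is in L^p(Omega). This
   domain contains W^{k,p}(Omega) if |alpha| <= k. It is the one on which
   D_alpha is closed: W^{k,p}(Omega) itself is too small (for alpha = 0,
   D_alpha is the identity on a non-closed subspace of L^p(Omega)). *)
Definition weak_diff Omega p alpha f u : Prop :=
  [/\ Lp Omega p f, Lp Omega p u & weak_deriv Omega alpha f u].

Definition sobolev Omega (k : nat) p : set ('rV[R]_n -> R) :=
  [set f | Lp Omega p f /\ forall beta : 'I_n -> nat,
    (midx_size beta <= k)%N ->
    exists u, weak_deriv Omega beta f u /\ Lp Omega p u].

(* sequential closedness of the graph in the metric space L^p x L^p *)
Definition closed_op Omega p
    (D : ('rV[R]_n -> R) -> ('rV[R]_n -> R) -> Prop) : Prop :=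
  forall (f_ u_ : nat -> 'rV[R]_n -> R) f u,
    (forall j, D (f_ j) (u_ j)) -> Lp Omega p f -> Lp Omega p u ->
    Lp_cvg Omega p f_ f -> Lp_cvg Omega p u_ u -> D f u.

(** ** The smooth algebra and its action *)

Record smoothing_net (phi : R -> 'rV[R]_n -> R) : Prop := SmoothingNet {
  net_ge0 : forall e, 0 < e -> forall x, 0 <= phi e x;
  net_bounded : forall e, 0 < e -> exists M, forall x, `|phi e x| <= M;
  net_integrable : forall e, 0 < e -> mu.-integrable setT (EFin \o phi e);
  net_Cc_smooth : forall e, 0 < e -> Cc_smooth setT (phi e);
  net_supp : forall e, 0 < e -> supp (phi e) `<=` eucl_cball e;
  net_int : forall e, 0 < e -> (\int[mu]_x phi e x = 1)%R }.

Definition smooth_act Omega (phi : 'rV[R]_n -> R) f : 'rV[R]_n -> R :=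
  fun x => (\int[mu]_(y in Omega) (phi (x - y) * f y))%R.

(* the x in Omega with x - supp phi contained in Omega, i.e. those for which
   y |-> phi (x - y) is a test function on Omega *)
Definition act_domain Omega (phi : 'rV[R]_n -> R) : set 'rV[R]_n :=
  [set x | Omega x /\ forall z, supp phi z -> Omega (x - z)].

(* D_alpha (phi_e f) = phi_e (D_alpha f), for f in the domain W. Both sides are
   functions on Omega, but within distance e of the boundary they differ in
   general (on ]0, 1[, take f = 1 and alpha = 1), so the identity is on
   [act_domain], which is R^n if Omega is R^n and always contains
   {x in Omega | dist(x, ~` Omega) > e}. *)
Definition equivariant Omega p alpha (W : set ('rV[R]_n -> R)) : Prop :=
  forall phi, smoothing_net phi -> forall e, 0 < e ->
  forall f u, W f -> weak_diff Omega p alpha f u ->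
    W (smooth_act Omega (phi e) f) /\
    weak_diff (act_domain Omega (phi e)) p alpha
      (smooth_act Omega (phi e) f) (smooth_act Omega (phi e) u).

End sobolev.

(* Main.v *)
Require Import Defs.
From HB Require Import structures.
From mathcomp Require Import all_boot all_order all_algebra.
From mathcomp Require Import all_classical all_reals all_analysis.
From mathcomp Require Import measurable_realfun ess_sup_inf ring.
Set Implicit Arguments.
Unset Strict Implicit.
Unset Printing Implicit Defensive.
Import Order.TTheory GRing.Theory Num.Theory.
Import numFieldNormedType.Exports.
Local Open Scope classical_set_scope.
Local Open Scope ring_scope.

(** The weak identities pair a function of L^p with a test function supported in
    a set K of finite measure, and by Hoelder the integral over K of |f| is at
    most (1 + |K|) ||f||_p; so they pass to L^p limits and D_alpha is closed.

    A function of L^p(Omega), extended by 0, has a convolution with phi in L^p,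
    and differentiating under the convolution puts the derivative on phi: by
    Fubini and integration by parts, the weak derivative of phi * f is
    (D_alpha phi) * f on all of Omega.  At a point x such that x - supp phi lies
    in Omega, y |-> phi (x - y) is a test function on Omega, and the definition
    of u = D_alpha f applied to it reads phi * u = (D_alpha phi) * f. *)

(** * Borel sets and Lebesgue measure on R^n *)

(** The boundary of Omega dictates the detour through [phi]: the extension of [u] by zero is in
    general not the weak derivative of the extension of [f]. Weak differentiability on all of Omega
    therefore comes from the convolution of [f] with a derivative of [phi], and [u] is compared with
    it only where the support of [phi] does not reach the boundary.

    Only integrals against test functions are compared: [f] is never approximated by smooth
    functions, so p = +oo needs no density argument. In place of Young's inequality, a test function
    is bounded by M times the indicator of a ball, so that a convolution at x sees only the part of
    [f] near x, where the local Hoelder bound applies.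

    Iterated integration by parts reverses the order of the single derivatives, while [partials]
    fixes that order; hence the symmetry of second derivatives. As the measure is built one
    coordinate at a time, measurability of open sets and translation invariance are drawn from the
    product structure. *)

Lemma measurable_rV_box (R : realType) n (A : 'I_n -> set R) :
  (forall i, measurable (A i)) ->
  measurable [set x : 'rV[R]_n | forall i, A i (x ord0 i)].
Proof.
move=> mA; rewrite [X in measurable X](_ : _ =
    \bigcap_(i in [set: 'I_n]) (rV_coord i @^-1` A i)); last first.
  by apply/seteqP; split => x Hx i; [move=> _|]; exact: Hx.
apply: fin_bigcap_measurable => // i _; rewrite -[X in measurable X]setTI.
exact: measurable_rV_coord.
Qed.

Lemma rV_ballE (R : realType) n (x : 'rV[R]_n) (r : R) : 0 < r ->
  ball x r = [set y | forall i, ball (x ord0 i) r (y ord0 i)].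
Proof.
move=> r0; apply/seteqP; split => y /=; first by move=> [_ H] i.
by move=> H; split => // i j; rewrite (ord1 i).
Qed.

Lemma measurable_rV_ball (R : realType) n (x : 'rV[R]_n) (r : R) :
  0 < r -> measurable (ball x r).
Proof.
move=> r0; rewrite rV_ballE//.
apply: (@measurable_rV_box _ _ (fun i => ball (x ord0 i) r)) => i.
by apply: open_measurable; exact: ball_open.
Qed.

Lemma lebesgue_rV_ball (R : realType) n (x : 'rV[R]_n) (r : R) :
  0 < r -> lebesgue_rV n (ball x r) = ((r *+ 2) ^+ n)%:E.
Proof.
move=> r0; rewrite rV_ballE//.
rewrite (@lebesgue_rV_box _ _ (fun i => ball (x ord0 i) r)).
  under eq_bigr do rewrite lebesgue_measure_ball ?ltW//.
  by rewrite prodEFin prodr_const card_ord.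
by move=> i; apply: open_measurable; exact: ball_open.
Qed.

(** The sigma-algebra is generated by the coordinates, so second countability is needed: an open set
    is the union of the balls inside it with rational centre and radius 1/(m+1), a countable union
    of boxes. *)
Lemma open_measurable_rV (R : realType) n (U : set 'rV[R]_n) :
  open U -> measurable U.
Proof.
move=> oU.
pose B (q : 'rV[rat]_n * nat) : set 'rV[R]_n :=
  ball (map_mx ratr q.1 : 'rV[R]_n) q.2.+1%:R^-1.
have -> : U = \bigcup_q (if `[< B q `<=` U >] then B q else set0).
  apply/seteqP; split => [x Ux|x [q _]]; last first.
    by case: asboolP => // BU; exact: BU.
  have /nbhs_ballP[e /= e0 eU] := oU x Ux.
  (* Twice the radius, by the triangle inequality: a ball whose centre is within 1/(m+1) of x lies
     in the ball of radius 2/(m+1) around x. *)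
  have [m me] : exists m, m.+1%:R^-1 *+ 2 < e.
    have [m me] := ltr_add_invr (divr_gt0 e0 (ltr0Sn R 1)).
    by exists m; move: me; rewrite add0r ltr_pdivlMr// mulr_natr.
  have d0 : 0 < m.+1%:R^-1 :> R by rewrite invr_gt0.
  have /choice[q qP] : forall i : 'I_n, exists q : rat,
      ball (x ord0 i) m.+1%:R^-1 (ratr q : R).
    move=> i; have xlt : x ord0 i - m.+1%:R^-1 < x ord0 i + m.+1%:R^-1.
      by rewrite ltrD2l gtrN.
    have [q qi] := rat_in_itvoo xlt.
    by exists q; rewrite ball_itv.
  have xq : B (\row_i q i, m) x.
    rewrite /B rV_ballE//= => i; rewrite !mxE; apply: ball_sym; exact: qP.
  exists (\row_i q i, m) => //; rewrite asboolT//.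
  move=> y By; apply: eU; apply: le_ball (ltW me) _ _.
  by rewrite mulr2n; apply: ball_triangle By; exact: ball_sym.
apply: countable_bigcupT_measurable; first exact: countableP.
by move=> q; case: asboolP => // _; apply: measurable_rV_ball; rewrite invr_gt0.
Qed.

Lemma continuous_measurable_rV (R : realType) n (f : 'rV[R]_n -> R) :
  continuous f -> measurable_fun setT f.
Proof.
move=> cf; apply: (measurability _ (RGenOpens.measurableE R)) =>
  _ [_ [a [b ->]] <-].
rewrite setTI; apply: open_measurable_rV.
by move/continuousP : cf; apply; exact: interval_open.
Qed.

Lemma compact_measurable_rV (R : realType) n (K : set 'rV[R]_n) :
  compact K -> measurable K.
Proof.
move=> cK; rewrite -[K]setCK; apply: measurableC; apply: open_measurable_rV.
by apply: closed_openC; apply: compact_closed => //; exact: norm_hausdorff.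
Qed.

Lemma compact_sub_ball (R : realType) n (K : set 'rV[R]_n) : compact K ->
  exists2 r, 0 < r & K `<=` ball 0 r.
Proof.
move=> /compact_bounded[M [_ MK]]; exists (`|M| + 2).
  by rewrite ltr_wpDl.
move=> x Kx; rewrite -ball_normE /= sub0r normrN.
have /MK /(_ _ Kx) /= : M < `|M| + 1 by rewrite (le_lt_trans (ler_norm _))//
  ltrDl.
by move=> /le_lt_trans; apply; rewrite ltrD2l ltr1n.
Qed.

Lemma compact_lebesgue_rV_lty (R : realType) n (K : set 'rV[R]_n) : compact K ->
  (lebesgue_rV n K < +oo)%E.
Proof.
move=> cK; have [r r0 Kr] := compact_sub_ball cK.
apply: (@le_lt_trans _ _ (lebesgue_rV n (ball 0 r))).
  apply: le_measure => //; rewrite inE; first exact: compact_measurable_rV.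
  exact: measurable_rV_ball.
by rewrite lebesgue_rV_ball// ltry.
Qed.

(** * Vector-valued measurable maps, translation invariance and Fubini *)

Lemma measurable_rV_coordP d (T : measurableType d) (R : realType) n
    (f : T -> 'rV[R]_n) :
  measurable_fun setT f <-> forall i, measurable_fun setT (fun x => f x ord0 i).
Proof.
split=> [mf i|mf]; last exact: measurable_fun_rVP.
by apply: (@measurableT_comp _ _ _ _ _ _ (rV_coord i)) => //;
  exact: measurable_rV_coord.
Qed.

Lemma measurable_rV_add d (T : measurableType d) (R : realType) n
    (f g : T -> 'rV[R]_n) :
  measurable_fun setT f -> measurable_fun setT g ->
  measurable_fun setT (fun x => f x + g x).
Proof.
move=> /measurable_rV_coordP mf /measurable_rV_coordP mg.
apply/measurable_rV_coordP => i; under eq_fun do rewrite mxE.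
exact: measurable_funD.
Qed.

Lemma measurable_rV_opp d (T : measurableType d) (R : realType) n
    (f : T -> 'rV[R]_n) :
  measurable_fun setT f -> measurable_fun setT (fun x => - f x).
Proof.
move=> /measurable_rV_coordP mf.
apply/measurable_rV_coordP => i; under eq_fun do rewrite mxE.
exact: measurableT_comp.
Qed.

(** The image of Lebesgue measure under a translation agrees with it on half-open intervals, hence
    everywhere by uniqueness. *)
Lemma ge0_integral_lebesgue_shift (R : realType) (f : R -> \bar R) (a : R) :
  measurable_fun setT f -> (forall x, 0 <= f x)%E ->
  (\int[lebesgue_measure]_x f (x + a)%R = \int[lebesgue_measure]_x f x)%E.
Proof.
move=> mf f0.
pose sh : R -> measurableTypeR R := fun x => x + a.
have msh : measurable_fun setT (sh : measurableTypeR R -> measurableTypeR R).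
  by apply: measurable_funD.
transitivity (\int[pushforward lebesgue_measure sh]_x f x)%E.
  by rewrite (ge0_integral_pushforward msh).
apply: eq_measure_integral => A mA _.
have e := isMeasurableFun.Build _ _ _ _ _ msh.
pose shm : {mfun measurableTypeR R >-> measurableTypeR R} := HB.pack sh e.
change (pushforward lebesgue_measure shm A = lebesgue_measure A).
apply/esym/lebesgue_measure_unique => //= _ [[b c]] _ <-.
rewrite /pushforward/= (_ : _ @^-1` _ = `](b - a), (c - a)]%classic).
  rewrite !lebesgue_measure_itv/= !lte_fin ltrD2r; case: ifPn => // _.
  by rewrite -!EFinD; congr EFin; ring.
by apply/seteqP; split => x /=; rewrite !in_itv/= /sh ltrBlDr lerBrDr.
Qed.

Lemma ge0_integral_rV_shift (R : realType) n
    (f : 'rV[R]_n -> \bar R) (v : 'rV[R]_n) :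
  measurable_fun setT f -> (forall x, 0 <= f x)%E ->
  (\int[lebesgue_rV n]_x f (x + v)%R = \int[lebesgue_rV n]_x f x)%E.
Proof.
elim: n f v => [|n IHn] f v mf f0.
  by apply: eq_integral => x _; rewrite [v]thinmx0 addr0.
have E (g : 'rV[R]_n.+1 -> \bar R) :
    measurable_fun setT g -> (forall x, 0 <= g x)%E ->
   (\int[lebesgue_rV n.+1]_x g x =
    \int[lebesgue_measure]_t \int[lebesgue_rV n]_y g (rV_cons (t, y)))%E.
  move=> mg g0.
  pose cons : measurableTypeR R * 'rV[R]_n -> 'rV[R]_n.+1 := rV_cons.
  have mcons : measurable_fun setT cons by exact: measurable_rV_cons.
  have mgc : measurable_fun setT (g \o cons) by exact: measurableT_comp.
  transitivity (\int[(@lebesgue_measure R \x lebesgue_rV n)%E]_z (g \o cons)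
    z)%E.
    rewrite -[in RHS](preimage_setT cons).
    by rewrite -(ge0_integral_pushforward mcons).
  exact: (@fubini_tonelli1 _ _ _ _ R lebesgue_measure (lebesgue_rV n) _ mgc
    (fun x => g0 (cons x))).
rewrite !E//; last first.
  apply: measurableT_comp => //; apply: measurable_rV_add => //.
have mfc : measurable_fun setT
    (f \o (rV_cons : measurableTypeR R * 'rV[R]_n -> 'rV[R]_n.+1)).
  by apply: measurableT_comp => //; exact: measurable_rV_cons.
pose v' : 'rV[R]_n := \row_i v ord0 (lift ord0 i).
have S t y : rV_cons (t, y) + v = rV_cons (t + v ord0 ord0, y + v').
  apply/rowP => i; rewrite !mxE; case: (unliftP ord0 i) => [j|] -> /=;
    last by [].
  by rewrite !mxE.
transitivity (\int[lebesgue_measure]_t \int[lebesgue_rV n]_y f (rV_cons ((t + v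
  ord0 ord0)%R, y)))%E.
  apply: eq_integral => t _.
  under eq_integral do rewrite S.
  rewrite (IHn (fun y => f (rV_cons ((t + v ord0 ord0)%R, y))) v')//.
  apply: (measurableT_comp mfc); exact: measurable_pair1.
apply: (@ge0_integral_lebesgue_shift _ (fun t =>
  \int[lebesgue_rV n]_y f (rV_cons (t, y)))%E).
  exact: (@measurable_fun_fubini_tonelli_F _ _ _ _ R (lebesgue_rV n) _ mfc
    (fun x => f0 (rV_cons x))).
by move=> t; apply: integral_ge0.
Qed.

Lemma integral_rV_shift (R : realType) n
    (f : 'rV[R]_n -> \bar R) (v : 'rV[R]_n) :
  measurable_fun setT f ->
  (\int[lebesgue_rV n]_x f (x + v)%R = \int[lebesgue_rV n]_x f x)%E.
Proof.
move=> mf; rewrite [LHS]integralE [RHS]integralE; congr (_ - _)%E.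
  rewrite -[RHS](ge0_integral_rV_shift v)//; last exact: measurable_funepos.
  by apply: eq_integral => x _; rewrite !funeposE.
rewrite -[RHS](ge0_integral_rV_shift v)//; last exact: measurable_funeneg.
by apply: eq_integral => x _; rewrite !funenegE.
Qed.

(** Every section, not merely almost every one, is assumed integrable: the inner integrals are then
    finite everywhere, and [fine] disappears under the outer integral. *)
Lemma Rintegral_fubini d1 d2 (T1 : measurableType d1) (T2 : measurableType d2)
    (R : realType)
    (m1 : {sigma_finite_measure set T1 -> \bar R})
    (m2 : {sigma_finite_measure set T2 -> \bar R}) (h : T1 * T2 -> R) :
  (m1 \x m2)%E.-integrable setT (EFin \o h) ->
  (forall x, m2.-integrable setT (fun y => (h (x, y))%:E)) ->
  (forall y, m1.-integrable setT (fun x => (h (x, y))%:E)) ->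
  \int[m1]_x \int[m2]_y h (x, y) = \int[m2]_y \int[m1]_x h (x, y).
Proof.
move=> ih i2 i1; rewrite /Rintegral; congr fine.
transitivity (\int[m1]_x \int[m2]_y (EFin \o h) (x, y))%E.
  by apply: eq_integral => x _; rewrite fineK//; apply: integrable_fin_num.
rewrite Fubini//.
by apply: eq_integral => y _; rewrite fineK//; apply: integrable_fin_num.
Qed.

(** * L^p norms *)

Section Lnorm_extra.
Context d (T : measurableType d) (R : realType).
Variable mu : {measure set T -> \bar R}.
Implicit Types (f g : T -> R) (p : \bar R).

Lemma Lfun_normP p f : f \in Lfun mu p <->
  measurable_fun setT f /\ ('N[mu]_p[EFin \o f] < +oo)%E.
Proof.
split=> [|[mf nf]]; first by rewrite inE => /andP[]; rewrite !inE.
by rewrite inE; apply/andP; rewrite !inE.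
Qed.

Lemma measurable_norm_powR f (r : R) : measurable_fun setT f ->
  measurable_fun setT (fun x => (`|f x| `^ r)).
Proof.
move=> mf; apply: (@measurableT_comp _ _ _ _ _ _ (@powR R ^~ r)) => //.
exact: measurableT_comp.
Qed.

Lemma le_Lnorm p f g : (1 <= p)%E ->
  measurable_fun setT f -> measurable_fun setT g ->
  (forall x, `|f x| <= `|g x|) ->
  ('N[mu]_p[EFin \o f] <= 'N[mu]_p[EFin \o g])%E.
Proof.
move=> + mf mg fg; rewrite unlock; case: p => [r| |]//=.
  rewrite lee_fin => r1.
  have r0 : 0 <= r by rewrite (le_trans ler01).
  apply: gt0_ler_poweR; first by rewrite invr_ge0.
  - by rewrite in_itv/= leey andbT integral_ge0// => x _;
    rewrite lee_fin powR_ge0.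
  - by rewrite in_itv/= leey andbT integral_ge0// => x _;
    rewrite lee_fin powR_ge0.
  apply: ge0_le_integral => //.
  - exact/measurable_EFinP/measurable_norm_powR.
  - exact/measurable_EFinP/measurable_norm_powR.
  - by move=> x _; rewrite lee_fin ge0_ler_powR// nnegrE.
move=> _; case: ifPn => // _; apply: le_ess_sup; apply: nearW => x /=.
by rewrite lee_fin.
Qed.

Lemma Lfun_le p f g : (1 <= p)%E -> measurable_fun setT f ->
  (forall x, `|f x| <= `|g x|) -> g \in Lfun mu p -> f \in Lfun mu p.
Proof.
move=> p1 mf fg /Lfun_normP[mg Ng]; apply/Lfun_normP; split => //.
by apply: le_lt_trans Ng; exact: le_Lnorm.
Qed.

(* The Hoelder constant is mu K to the power 1 - 1/p; bounding it by 1 + mu K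
   treats p = 1 and p = +oo alike. *)
Lemma integral_le_Lnorm p f (K : set T) : (0 < mu setT)%E -> (1 <= p)%E ->
  measurable_fun setT f -> measurable K -> (mu K < +oo)%E ->
  (forall x, ~ K x -> f x = 0) ->
  (\int[mu]_x `|f x|%:E <= (1 + mu K) * 'N[mu]_p[EFin \o f])%E.
Proof.
move=> mu0 + mf mK Koo fK.
have C1 : (1 <= 1 + mu K)%E by rewrite leeDl.
have L1 : (\int[mu]_x `|f x|%:E = 'N[mu]_1[EFin \o f])%E by rewrite Lnorm1.
case: p => [r| |]//=.
(* The exponent 1 stands apart, since its conjugate is infinite; there it suffices that 1 + mu K is
   at least 1. *)
- rewrite lee_fin le_eqVlt => /predU1P[<-|r1].
    by rewrite L1 lee_pemull// Lnorm_ge0.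
  have r0 : 0 < r by rewrite (lt_trans ltr01).
  have q0 : 0 < 1 - r^-1 by rewrite subr_gt0 invf_lt1.
  have qE : r^-1 + (1 - r^-1)^-1^-1 = 1 by rewrite invrK addrC subrK.
  have q'0 : 0 < (1 - r^-1)^-1 by rewrite invr_gt0.
  have H := @hoelder _ _ _ mu f \1_K r _ mf (measurable_indic mK) r0 q'0 qE.
  rewrite L1 (@eq_Lnorm _ _ _ mu 1 (EFin \o f) (EFin \o (f \* \1_K)%R));
    last first.
    move=> x /=; rewrite indicE; have [Kx|nKx] := pselect (K x).
      by rewrite mem_set// mulr1.
    by rewrite fK// mul0r.
  apply: (le_trans H).
  rewrite muleC; apply: lee_pmul; rewrite ?Lnorm_ge0//.
  rewrite unlock invrK.
    have -> : (\int[mu]_x (`|(EFin \o \1_K) x| `^ (1 - r^-1)^-1) = mu K)%E.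
      rewrite -[in RHS](setIT K) -integral_indic//.
      apply: eq_integral => x _ /=.
      by rewrite indicE; case: (x \in K);
        rewrite /= ?normr1 ?normr0 ?powR1// powR0// gt_eqF// invr_gt0.
    have [m mE] : exists m : R, mu K = m%:E.
      by exists (fine (mu K)); rewrite fineK// ge0_fin_numE.
    have m0 : 0 <= m by rewrite -lee_fin -mE.
    rewrite mE poweR_EFin -EFinD lee_fin.
    have q1 : 1 - r^-1 <= 1 by rewrite gerBl invr_ge0 ltW.
    (* The power m^(1 - 1/r) is at most 1 if m <= 1 and at most m otherwise. *)
    have [m1|m1] := leP m 1.
      have : m `^ (1 - r^-1) <= 1 `^ (1 - r^-1) by rewrite ge0_ler_powR//
        ?nnegrE// ltW.
      rewrite powR1 => /le_trans; apply; by rewrite lerDl.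
    have : m `^ (1 - r^-1) <= m `^ 1 by rewrite ler_powR// ltW.
    rewrite powRr1// => /le_trans; apply; by rewrite lerDr.
move=> _.
(* The norm for p = +oo is an essential supremum only when the space has positive measure, hence
   [mu0]. *)
rewrite [in leRHS]unlock mu0.
set N := ess_sup mu _.
have N0 : (0 <= N)%E by apply: ess_sup_gee => //; apply: nearW => x /=;
  rewrite lee_fin.
have -> : (\int[mu]_x `|f x|%:E = \int[mu]_(x in K) `|f x|%:E)%E.
  rewrite [RHS]integral_mkcond; apply: eq_integral => x _.
  rewrite patchE; case: ifPn => // /negP; rewrite inE => nK.
  by rewrite fK// normr0.
have aeN : {ae mu, forall x, (`|f x|%:E <= N)%E}.
  exact: (ess_sup_ge mu (abse \o (EFin \o f))).
have [Noo|Nfin] := eqVneq N +oo%E.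
  by rewrite Noo gt0_muley ?leey// (lt_le_trans _ C1).
apply: (@le_trans _ _ (\int[mu]_(x in K) N)%E).
  apply: ae_ge0_le_integral => //.
  - by apply/measurable_EFinP; apply: measurable_funTS; exact: measurableT_comp.
  - by apply: filterS aeN => x ? _.
rewrite integral_cst// muleC; apply: lee_wpmul2r => //.
by rewrite leeDr.
Qed.

End Lnorm_extra.

(** * Partial derivatives of smooth functions *)

Section directional.
Context (R : realType) (V : normedModType R).
Implicit Types (f : V -> R) (x v a : V).

Lemma is_derive_line f x v t : derivable f (x + t *: v) v ->
  is_derive t 1 (fun s : R => f (x + s *: v)) ('D_v f (x + t *: v)).
Proof.
move=> df.
have E : (fun h : R => h^-1 *:
      (((fun s : R => f (x + s *: v)) \o shift t) (h *: (1 : R)) -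
       f (x + t *: v))) =
    (fun h : R => h^-1 *: ((f \o shift (x + t *: v)) (h *: v) - f (x + t *: v))).
  apply/funext => h /=; congr (_ *: (f _ - _)).
  by rewrite [h *: 1]mulr1 scalerDl addrCA.
by split; rewrite /derivable /derive/= ?E.
Qed.

Lemma cvg_mull_dnbhs0 (s : R) : s != 0 -> (s * h) @[h --> 0^'] --> 0^'.
Proof.
move=> s0 A /nbhs_ballP[e /= e0 eA].
apply/nbhs_ballP; exists (e / `|s|); first by rewrite /= divr_gt0// normr_gt0.
move=> h /=; rewrite -ball_normE /= sub0r normrN => hes h0.
apply: eA; last by rewrite mulf_neq0.
by rewrite -ball_normE /= sub0r normrN normrM mulrC -ltr_pdivlMr// normr_gt0.
Qed.

(** Only a directional derivative is assumed, which rules out the chain rule for differentiable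
    maps. Instead, the quotient at step h is c s times that of [f] at step s h, and s != 0 keeps s h
    off 0. *)
Lemma is_derive_affine f x v a (c s : R) : s != 0 ->
  derivable f (a + s *: x) v ->
  is_derive x v (fun y => c * f (a + s *: y)) (c * s * 'D_v f (a + s *: x)).
Proof.
move=> s0 df; set p := a + s *: x.
pose D (t : R) := t^-1 *: (f (t *: v + p) - f p).
have DL : D t @[t --> 0^'] --> 'D_v f p by exact: df.
have DsL : c * s * D (s * t) @[t --> 0^'] --> c * s * 'D_v f p.
  by apply: cvgMr; apply: cvg_comp DL; exact: cvg_mull_dnbhs0.
have E : (fun h : R => h^-1 *:
      (((fun y => c * f (a + s *: y)) \o shift x) (h *: v) - c * f p)) =
    (fun t => c * s * D (s * t)).
  apply/funext => h /=; rewrite /D.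
  have -> : a + s *: (h *: v + x) = (s * h) *: v + p.
    by rewrite scalerDr scalerA addrCA.
  by rewrite /GRing.scale/= invfM -mulrBr !mulrA mulfK// [h^-1 * c]mulrC.
by split; rewrite /derivable /derive/= E; [exact: cvgP DsL|exact: cvg_lim DsL].
Qed.

(** The bound |c| <= |t| replaces a position between 0 and t, so that both signs of t are covered by
    one statement. *)
Lemma mean_value_line f x v (t : R) : (forall y, derivable f y v) ->
  exists2 c : R, `|c| <= `|t| & f (x + t *: v) - f x = t * 'D_v f (x + c *: v).
Proof.
move=> df; pose g (s : R) := f (x + s *: v).
have dg (s : R) : is_derive s (1 : R) g ('D_v f (x + s *: v)) by exact:
  is_derive_line.
have cg (a b : R) : {within `[a, b], continuous g}.
  by apply: derivable_within_continuous => s _; have [] := dg s.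
have g0 : g 0 = f x by rewrite /g scale0r addr0.
have [t0|t0] := leP 0 t.
  have [c] := @MVT_segment _ g (fun s => 'D_v f (x + s *: v)) 0 t t0
    (fun s _ => dg s) (cg 0 t).
  rewrite in_itv/= => /andP[c0 ct]; rewrite subr0 g0 => E.
  by exists c; [rewrite !ger0_norm|rewrite [LHS]E mulrC].
have [c] := @MVT_segment _ g (fun s => 'D_v f (x + s *: v)) t 0 (ltW t0)
  (fun s _ => dg s) (cg t 0).
rewrite in_itv/= => /andP[tc c0]; rewrite sub0r g0 => E.
exists c; first by rewrite !ler0_norm ?lerN2// ltW.
by rewrite -[LHS]opprB [X in - X]E mulrN opprK mulrC.
Qed.

End directional.

Section partials_theory.
Context (R : realType) (n : nat).
Local Notation e_ i := (delta_mx ord0 i : 'rV[R]_n).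
Implicit Types (f g : 'rV[R]_n -> R) (i j : 'I_n).

Lemma Ck_continuous m f : Ck m f -> continuous f.
Proof. by case: m => [//|m] []. Qed.

Lemma CkW m f : Ck m.+1 f -> Ck m f.
Proof.
elim: m f => [|m IHm] f [cf df]; first by [].
split=> // i; have [dfi Cfi] := df i; split => //; exact: IHm.
Qed.

Lemma smooth_continuous f : smooth f -> continuous f.
Proof. by move=> /(_ 0). Qed.

Lemma smooth_derivable f i x : smooth f -> derivable f x (e_ i).
Proof. by move=> /(_ 1)[_ /(_ i)[]]. Qed.

Lemma smooth_partial f i : smooth f -> smooth (partial i f).
Proof. by move=> sf m; have [_ /(_ i)[]] := sf m.+1. Qed.

Lemma partial_affine f i (c s : R) a : s != 0 ->
  (forall x, derivable f x (e_ i)) ->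
  partial i (fun y => c * f (a + s *: y)) =
  (fun y => c * s * partial i f (a + s *: y)).
Proof.
by move=> s0 df; apply/funext => x;
  have [] := @is_derive_affine R _ f x (e_ i) a c s s0 (df _).
Qed.

(** The factor [c] is there for the induction: each derivative multiplies it by [s]. *)
Lemma Ck_affine m f (c s : R) a : s != 0 -> Ck m f ->
  Ck m (fun y => c * f (a + s *: y)).
Proof.
move=> s0; elim: m f c => [|m IHm] f c.
  move=> cf x; apply: continuousM; first exact: cst_continuous.
  apply: continuous_comp (cf _).
  apply: continuousD; first exact: cst_continuous.
  exact: scaler_continuous.
move=> [cf df]; split.
  have /= := IHm f c (CkW (conj cf df)); exact: Ck_continuous.
move=> i; have [dfi Cfi] := df i; split.
  by move=> x; have [] := @is_derive_affine R _ f x (e_ i) a c s s0 (dfi _).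
by rewrite partial_affine//; exact: IHm.
Qed.

(** The mean value theorem twice: along e_i for y |-> f (y + t e_j) - f y, then along e_j for the
    i-th partial derivative. *)
Lemma second_difference f i j x (t : R) :
  (forall x, derivable f x (e_ i)) ->
    (forall x, derivable (partial i f) x (e_ j)) ->
  exists c d : R, [/\ `|c| <= `|t|, `|d| <= `|t| &
   f (x + t *: e_ i + t *: e_ j) - f (x + t *: e_ i) - (f (x + t *: e_ j) - f x)
   = t ^+ 2 * partial j (partial i f) (x + c *: e_ i + d *: e_ j)].
Proof.
move=> df ddf; pose g y := f (y + t *: e_ j) - f y.
have dg y : is_derive y (e_ i) g (partial i f (y + t *: e_ j) - partial i f y).
  apply: is_deriveB; last exact: derivableP.
  have := @is_derive_affine _ _ f y (e_ i) (t *: e_ j) 1 1.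
  rewrite !mul1r scale1r addrC => /(_ (oner_neq0 _) (df _)).
  by under eq_fun do rewrite mul1r scale1r addrC.
have [c ct E1] := @mean_value_line _ _ g x (e_ i) t
  (fun y => @ex_derive _ _ _ _ _ _ _ (dg y)).
have [d dt E2] := @mean_value_line _ _ (partial i f) (x + c *: e_ i) (e_ j) t
  (ddf).
exists c, d; split => //.
move: E1; rewrite /g (@derive_val _ _ _ _ _ _ _ (dg _)) E2.
by rewrite addrAC => ->; rewrite mulrA.
Qed.

(* Both sides are limits of the same second difference divided by t^2. *)
Lemma partialC f i j : smooth f ->
  partial i (partial j f) = partial j (partial i f).
Proof.
move=> sf; apply/funext => x; apply/eqP; rewrite -subr_eq0 -normr_le0.
apply/ler_addgt0Pr => _/posnumP[e]; rewrite add0r.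
have close (a b c d : R) : `|a - b| < e%:num / 2 -> `|c - d| < e%:num / 2 ->
    d = b -> `|a - c| <= e%:num.
  move=> ab cd db; rewrite -(subrKA b); apply: (le_trans (ler_normD _ _)).
  by rewrite (splitr e%:num) lerD// ltW// -db distrC.
have ca : {for x, continuous (partial i (partial j f))}.
  by apply: smooth_continuous; do 2 apply: smooth_partial.
have cb : {for x, continuous (partial j (partial i f))}.
  by apply: smooth_continuous; do 2 apply: smooth_partial.
have /nbhs_normP[a /= a0 Ha] : \forall y \near x, `|partial i (partial j f) x -
  partial i (partial j f) y| < e%:num / 2.
  by move/cvgrPdist_lt : ca; apply.
have /nbhs_normP[b /= b0 Hb] : \forall y \near x, `|partial j (partial i f) x -
  partial j (partial i f) y| < e%:num / 2.
  by move/cvgrPdist_lt : cb; apply.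
pose m := Num.min a b; have m0 : 0 < m by rewrite lt_min a0.
(* With t = m / N, both intermediate points are within t (|e_i| + |e_j|) < m of x; the summand 1
   makes this strict and N positive. *)
pose N := `|e_ i| + `|e_ j| + 1; have N0 : 0 < N by rewrite ltr_wpDl// addr_ge0.
pose t := m / N; have t0 : 0 < t by rewrite divr_gt0.
have near_x i' j' (c d : R) : `|c| <= `|t| -> `|d| <= `|t| ->
    `|e_ i'| + `|e_ j'| < N ->
    `|x - (x + c *: e_ i' + d *: e_ j')| < m.
  move=> ct dt ijN.
  rewrite -addrA opprD addrA subrr sub0r normrN.
  apply: (le_lt_trans (ler_normD _ _)); rewrite !normrZ.
  apply: (@le_lt_trans _ _ (`|t| * (`|e_ i'| + `|e_ j'|))).
    by rewrite mulrDr lerD// ler_wpM2r.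
  by rewrite gtr0_norm// /t mulrAC ltr_pdivrMr// ltr_pM2l.
have ijN : `|e_ i| + `|e_ j| < N by rewrite ltrDl.
have jiN : `|e_ j| + `|e_ i| < N by rewrite addrC.
have [c [d [ct dt E1]]] := @second_difference f i j x t
  (fun y => smooth_derivable sf)
  (fun y => smooth_derivable (smooth_partial _ sf)).
have [c' [d' [ct' dt' E2]]] := @second_difference f j i x t
  (fun y => smooth_derivable sf)
  (fun y => smooth_derivable (smooth_partial _ sf)).
have := near_x _ _ _ _ ct dt ijN; rewrite lt_min => /andP[_ /Hb {}Hb].
have := near_x _ _ _ _ ct' dt' jiN; rewrite lt_min => /andP[/Ha {}Ha _].
(* The second difference is symmetric in i and j, so the two mean values coincide after division by
   t^2. *)
have E0 : f (x + t *: e_ i + t *: e_ j) - f (x + t *: e_ i) -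
      (f (x + t *: e_ j) - f x) =
    f (x + t *: e_ j + t *: e_ i) - f (x + t *: e_ j) -
      (f (x + t *: e_ i) - f x).
  rewrite (addrAC x) [LHS]addrAC opprB addrA [RHS]addrAC opprB addrA.
  by rewrite [in RHS]addrAC.
have t2 : t ^+ 2 != 0 by rewrite expf_neq0// gt_eqF.
exact: close Ha Hb (mulfI t2 (etrans (esym E1) (etrans E0 E2))).
Qed.

End partials_theory.

(** * Test functions and integration by parts *)

Lemma integrable_bounded_mul d (T : measurableType d) (R : realType)
    (mu : {measure set T -> \bar R}) (f h : T -> R) (M : R) :
  measurable_fun setT f -> (forall x, `|f x| <= M) ->
  mu.-integrable setT (EFin \o h) ->
  mu.-integrable setT (fun x => (f x * h x)%:E).
Proof.
move=> mf fM ih; have mh := measurable_int mu ih.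
apply: (@le_integrable _ _ _ mu setT measurableT _
  (fun x => (M%:E * (EFin \o h) x)%E)).
- by apply/measurable_EFinP; apply: measurable_funM => //;
  exact/measurable_EFinP.
- move=> x _ /=; rewrite lee_fin !normrM ler_wpM2r//.
  by rewrite (le_trans (fM x))// ler_norm.
- exact: integrableZl.
Qed.

Section iterated_partials.
Context (R : realType) (n : nat).
Implicit Types (f g h : 'rV[R]_n -> R) (i : 'I_n) (l : seq 'I_n).
Implicit Types (Omega : set 'rV[R]_n).
Local Notation e_ i := (delta_mx ord0 i : 'rV[R]_n).
Local Notation mu := (lebesgue_rV n : {measure set 'rV[R]_n -> \bar R}).

(** A mixed derivative as a list of single ones, so that proofs can induct on one derivative at a
    time. *)
Definition iter_partial l f : 'rV[R]_n -> R := foldr (@partial R n) f l.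

Definition midx_seq (alpha : 'I_n -> nat) : seq 'I_n :=
  flatten [seq nseq (alpha i) i | i <- enum 'I_n].

Lemma partialsE alpha f : partials alpha f = iter_partial (midx_seq alpha) f.
Proof.
rewrite /partials /midx_seq /iter_partial; elim: (enum _) => //= i s IHs.
rewrite foldr_cat -IHs.
by elim: (alpha i) => //= k ->.
Qed.

Lemma size_midx_seq alpha : size (midx_seq alpha) = midx_size alpha.
Proof.
rewrite size_flatten /shape -map_comp sumnE big_map big_enum/=.
by apply: eq_bigr => i _; rewrite /= size_nseq.
Qed.

Lemma smooth_iter_partial l f : smooth f -> smooth (iter_partial l f).
Proof. by move=> sf; elim: l => //= i l; exact: smooth_partial. Qed.

(** Integration by parts takes the outermost derivative off one factor and makes it the innermost on
    the other; this puts it back outside. *)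
Lemma iter_partialC l i f : smooth f ->
  iter_partial l (partial i f) = partial i (iter_partial l f).
Proof.
move=> sf; elim: l => //= j l ->.
by rewrite partialC//; exact: smooth_iter_partial.
Qed.

Lemma iter_partial_affine l f (s : R) a : s != 0 -> smooth f ->
  iter_partial l (fun y => f (a + s *: y)) =
  (fun y => s ^+ size l * iter_partial l f (a + s *: y)).
Proof.
move=> s0 sf; elim: l => [|i l IHl] /=.
  by apply/funext => y; rewrite expr0 mul1r.
rewrite IHl partial_affine//; first by rewrite exprSr.
by move=> x; apply: smooth_derivable; exact: smooth_iter_partial.
Qed.

Lemma supp0 f x : ~ supp f x -> f x = 0.
Proof.
by move=> sfx; apply/eqP; apply: contra_notT sfx => fx; exact: subset_closure.
Qed.

Lemma supp_partial i f : supp (partial i f) `<=` supp f.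
Proof.
have cs : closed (supp f) by exact: closed_closure.
rewrite (closure_id (supp f)).1//.
apply: closure_subset => x; apply: contraNP => nsx; apply/eqP.
have nx : \forall y \near x, f y = cst 0 y.
  have : nbhs x (~` supp f).
    by apply: open_nbhs_nbhs; split => //; apply: closed_openC;
      exact: closed_closure.
  by apply: filterS => y; exact: supp0.
by rewrite /partial (near_eq_derive _ nx) derive_cst.
Qed.

Lemma Cc_smooth_partial Omega i f : Cc_smooth Omega f ->
  Cc_smooth Omega (partial i f).
Proof.
move=> [sf cf fO]; split; first exact: smooth_partial.
- apply: subclosed_compact cf _; [exact: closed_closure|exact: supp_partial].
- by apply: subset_trans fO; exact: supp_partial.
Qed.

Lemma Cc_smooth_iter_partial Omega l f :
  Cc_smooth Omega f -> Cc_smooth Omega (iter_partial l f).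
Proof. by move=> cf; elim: l => //= i l; exact: Cc_smooth_partial. Qed.

(** The form in which test functions enter the convolution estimates: one bound that records both
    size and support. *)
Lemma Cc_smooth_le_indic Omega f : Cc_smooth Omega f ->
  exists2 r, 0 < r & exists M : R, forall x, `|f x| <= M * \1_(ball 0 r) x.
Proof.
move=> [sf cf _]; have [r r0 fr] := compact_sub_ball cf; exists r => //.
have : compact (f @` supp f).
  by apply: continuous_compact => //; apply: continuous_subspaceT;
    exact: smooth_continuous.
move=> /compact_bounded[M [_ /(_ (`|M| + 1))]].
rewrite (le_lt_trans (ler_norm _)) ?ltrDl// => /(_ isT) H.
exists (`|M| + 1) => x.
have [sx|nsx] := pselect (supp f x).
  by rewrite indicE mem_set ?mulr1; [apply: H; exists x|exact: fr].
by rewrite supp0// normr0 mulr_ge0// addr_ge0.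
Qed.

Lemma Cc_smooth_bounded Omega f : Cc_smooth Omega f ->
  exists M : R, forall x, `|f x| <= M.
Proof.
move=> /Cc_smooth_le_indic[r r0 [M fM]]; exists M => x.
have M0 : 0 <= M.
  have := fM 0; rewrite indicE mem_set ?mulr1; last exact: ballxx.
  exact: le_trans.
by rewrite (le_trans (fM x))// indicE; case: (_ \in _); rewrite ?mulr1 ?mulr0.
Qed.

Lemma Cc_smooth_measurable Omega f : Cc_smooth Omega f -> measurable_fun setT f.
Proof. by move=> [/smooth_continuous + _ _];
  exact: continuous_measurable_rV. Qed.

Lemma integrable_rV_ball x r : 0 < r ->
  mu.-integrable setT (EFin \o \1_(ball x r)).
Proof.
move=> r0; apply/integrableP; split.
  by apply/measurable_EFinP/measurable_indic; exact: measurable_rV_ball.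
under eq_integral do rewrite /= ger0_norm//.
rewrite integral_indic//; last exact: measurable_rV_ball.
by rewrite setIT; rewrite [ltLHS]lebesgue_rV_ball// ltry.
Qed.

Lemma Cc_smooth_integrable Omega f : Cc_smooth Omega f ->
  mu.-integrable setT (EFin \o f).
Proof.
move=> cf; have [r r0 [M fM]] := Cc_smooth_le_indic cf.
have iM : mu.-integrable setT (fun x => (M * \1_(ball 0 r) x)%:E).
  under eq_fun do rewrite EFinM.
  by apply: integrableZl => //; exact: integrable_rV_ball.
apply: (le_integrable measurableT _ _ iM).
- by apply/measurable_EFinP; exact: Cc_smooth_measurable cf.
- by move=> x _ /=; rewrite lee_fin (le_trans (fM x))// ler_norm.
Qed.

Lemma measurable_rV_shift f (v : 'rV[R]_n) : measurable_fun setT f ->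
  measurable_fun setT (fun x : 'rV[R]_n => f (x + v)).
Proof. by move=> mf; apply: measurableT_comp => //;
  exact: measurable_rV_add. Qed.

(** Dominated convergence: by the mean value theorem the quotients of [g] are bounded by a bound M
    of its partial derivative, so M |h| dominates. *)
Lemma cvg_difference_quotient i g h (t_ : nat -> R) :
  Cc_smooth setT g -> mu.-integrable setT (EFin \o h) ->
  (forall k, t_ k != 0) -> t_ k @[k --> \oo] --> 0 ->
  \int[mu]_x ((g (x + t_ k *: e_ i) - g x) / t_ k * h x) @[k --> \oo] -->
  \int[mu]_x (partial i g x * h x).
Proof.
move=> cg ih tn0 t0.
have mg := Cc_smooth_measurable cg.
have [M gM] := Cc_smooth_bounded (Cc_smooth_partial i cg).
have mh : measurable_fun setT h by apply/measurable_EFinP;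
  exact: measurable_int ih.
have dg y : derivable g y (e_ i) by case: cg => sg _ _; exact: smooth_derivable.
pose f_ k x := ((g (x + t_ k *: e_ i) - g x) / t_ k * h x)%:E.
have := @dominated_convergence _ _ _ mu setT measurableT f_
  (fun x => (partial i g x * h x)%:E)
  (fun x => (M%:E * (abse \o (EFin \o h)) x)%E).
case.
- move=> k; apply/measurable_EFinP; apply: measurable_funM => //.
  apply: measurable_funM => //; apply: measurable_funB => //;
    exact: measurable_rV_shift.
- apply/measurable_EFinP; apply: measurable_funM => //.
  exact: Cc_smooth_measurable (Cc_smooth_partial i cg).
- apply: aeW => x _; apply: cvg_EFin; first by apply: nearW.
  rewrite /f_ /=; apply: cvgMl.
  have DL : t^-1 *: ((g \o shift x) (t *: e_ i) - g x) @[t --> 0^'] --> partial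
    i g x.
    exact: dg.
  have tk0 : t_ k @[k --> \oo] --> 0^'.
    move=> A A0; have : \forall k \near \oo, t_ k != 0 ->
      A (t_ k) by exact: (t0 _ A0).
    by apply: filterS => k; apply; exact: tn0.
  have := cvg_comp _ _ tk0 DL; apply: cvg_trans; apply: near_eq_cvg.
  by apply: nearW => k /=; rewrite [x + _]addrC /GRing.scale/= mulrC.
- by apply: integrableZl => //; exact: integrable_abse.
- apply: aeW => x k _; rewrite /f_ /= lee_fin normrM ler_wpM2r//.
  have [c _ ->] := @mean_value_line _ _ g x (e_ i) (t_ k) dg.
  by rewrite mulrAC divff// mul1r; exact: gM.
move=> il _ fcvg; apply: fine_cvg.
by rewrite fineK//; exact: integrable_fin_num il.
Qed.

(* Translation invariance moves the difference quotient from g to h, so neither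
   the product rule nor an iterated integral is needed. *)
Lemma integration_by_parts i g h : Cc_smooth setT g -> Cc_smooth setT h ->
  \int[mu]_x (partial i g x * h x) = - \int[mu]_x (g x * partial i h x).
Proof.
move=> cg ch.
have ig := Cc_smooth_integrable cg; have ih := Cc_smooth_integrable ch.
have mg := Cc_smooth_measurable cg; have mh := Cc_smooth_measurable ch.
have [Mg gM] := Cc_smooth_bounded cg; have [Mh hM] := Cc_smooth_bounded ch.
have [t_ tn0 t0] : exists2 t_ : nat -> R,
    (forall k, t_ k != 0) & t_ k @[k --> \oo] --> 0.
  exists (fun k => k.+1%:R^-1); last exact: cvg_harmonic.
  by move=> k; rewrite invr_eq0 pnatr_eq0.
(* Moving a translation by t_k from [g] to [h] reverses it, so the quotients of [h] run along -
   t_k. *)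
have tNn0 k : - t_ k != 0 by rewrite oppr_eq0.
have tN0 : - t_ k @[k --> \oo] --> 0 by rewrite -oppr0; exact: cvgN.
have A := @cvg_difference_quotient i _ _ _ cg ih tn0 t0.
have B := @cvg_difference_quotient i _ _ _ ch ig tNn0 tN0.
have /(cvg_unique _ A) : \int[mu]_x ((g (x + t_ k *: e_ i) - g x) / t_ k * h x)
  @[k --> \oo] -->
   - \int[mu]_x (partial i h x * g x).
  apply: cvg_trans (cvgN B); apply: near_eq_cvg; apply: nearW => k /=.
  have S : \int[mu]_x (g (x + t_ k *: e_ i) * h x) =
    \int[mu]_x (h (x - t_ k *: e_ i) * g x).
    rewrite /Rintegral; congr fine.
    rewrite -[RHS](integral_rV_shift (t_ k *: e_ i)).
      by apply: eq_integral => x _; rewrite addrK mulrC.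
    apply/measurable_EFinP; apply: measurable_funM => //;
      exact: measurable_rV_shift.
  have E (a b : 'rV[R]_n -> R) (Ma : R) (t : R) v : measurable_fun setT a ->
    (forall x, `|a x| <= Ma) ->
      mu.-integrable setT (EFin \o b) ->
      \int[mu]_x ((a (x + v) - a x) / t * b x) =
      t^-1 * (\int[mu]_x (a (x + v) * b x) - \int[mu]_x (a x * b x)).
    move=> ma aM ib.
    have i1 : mu.-integrable setT (fun x => (a (x + v) * b x)%:E).
      by apply: (@integrable_bounded_mul _ _ _ _ _ _ Ma) => //;
        exact: measurable_rV_shift.
    have i2 : mu.-integrable setT (fun x => (a x * b x)%:E).
      by apply: (@integrable_bounded_mul _ _ _ _ _ _ Ma).
    rewrite -RintegralB// -RintegralZl//;
      last exact: (integrableB measurableT i1 i2).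
    by apply: eq_Rintegral => x _; rewrite mulrAC mulrBl mulrC.
  rewrite opprfctE (E h g Mh _ (- t_ k *: e_ i) mh hM ig)
    (E g h Mg _ (t_ k *: e_ i) mg gM ih).
  rewrite S scaleNr invrN mulNr opprK; congr (_ * (_ - _)).
  by apply: eq_Rintegral => x _; rewrite mulrC.
move=> ->//; congr (- _).
by apply: eq_Rintegral => x _; rewrite mulrC.
Qed.

Lemma iter_integration_by_parts l g h : Cc_smooth setT g -> Cc_smooth setT h ->
  \int[mu]_x (iter_partial l g x * h x) =
  (-1) ^+ size l * \int[mu]_x (g x * iter_partial l h x).
Proof.
move=> cg; elim: l h => [|i l IHl] h ch; first by rewrite expr0 mul1r.
rewrite [LHS]/= integration_by_parts//; last exact: Cc_smooth_iter_partial.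
rewrite IHl; last exact: Cc_smooth_partial.
rewrite iter_partialC; last by case: ch.
by rewrite exprS mulN1r mulNr.
Qed.

End iterated_partials.

(** * Convolution with a test function *)

(** Tonelli gives this for non-negative functions; the integral is the difference of those of the
    positive and negative parts. *)
Lemma measurable_fun_integral d1 d2 (T1 : measurableType d1)
    (T2 : measurableType d2) (R : realType)
    (m2 : {sigma_finite_measure set T2 -> \bar R}) (h : T1 * T2 -> \bar R) :
  measurable_fun setT h -> measurable_fun setT (fun x => \int[m2]_y h (x, y))%E.
Proof.
move=> mh; under eq_fun do rewrite integralE.
apply: emeasurable_funB.
  have := @measurable_fun_fubini_tonelli_F _ _ _ _ R m2 _ (measurable_funepos
    mh) (fun x => funepos_ge0 h x).
  by congr measurable_fun; apply/funext => x; apply: eq_integral => y _;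
    rewrite !funeposE.
have := @measurable_fun_fubini_tonelli_F _ _ _ _ R m2 _ (measurable_funeneg mh)
  (fun x => funeneg_ge0 h x).
by congr measurable_fun; apply/funext => x; apply: eq_integral => y _;
  rewrite !funenegE.
Qed.

Section convolution_theory.
Context (R : realType) (n : nat).
Implicit Types (f g F psi : 'rV[R]_n -> R) (l : seq 'I_n).
Implicit Types (Omega : set 'rV[R]_n) (p : \bar R).
Local Notation mu := (lebesgue_rV n : {measure set 'rV[R]_n -> \bar R}).

Lemma lebesgue_rV_setT_gt0 : (0 < lebesgue_rV n [set: 'rV[R]_n])%E.
Proof.
apply: (@lt_le_trans _ _ (lebesgue_rV n (ball (0 : 'rV[R]_n) 1))).
  by rewrite lebesgue_rV_ball// lte_fin exprn_gt0// pmulrn_lgt0.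
by apply: le_measure => //; rewrite inE//; exact: measurable_rV_ball.
Qed.

Lemma Lfun_integrable_indic p F (K : set 'rV[R]_n) : (1 <= p)%E ->
  F \in Lfun mu p ->
  measurable K -> (lebesgue_rV n K < +oo)%E ->
  mu.-integrable setT (fun y => (F y * \1_K y)%:E).
Proof.
move=> p1 /Lfun_normP[mF NF] mK Koo.
have mFK : measurable_fun setT (F \* \1_K)%R by apply: measurable_funM => //;
  exact: measurable_indic.
apply/integrableP; split; first exact/measurable_EFinP.
apply: le_lt_trans (integral_le_Lnorm lebesgue_rV_setT_gt0 p1 mFK mK Koo _) _.
  by move=> x Kx /=; rewrite indicE memNset// mulr0.
apply: (@le_lt_trans _ _ ((1 + lebesgue_rV n K) * 'N[mu]_p[EFin \o F])%E).
  apply: lee_wpmul2l; first by rewrite adde_ge0.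
  apply: le_Lnorm => // x /=; rewrite normrM indicE.
  by case: (_ \in _); rewrite ?normr1 ?mulr1 ?normr0 ?mulr0.
by rewrite lte_mul_pinfty// ?adde_ge0// ge0_fin_numE ?adde_ge0//
  lte_add_pinfty// ltry.
Qed.

(** The integral runs over all of R^n, with [F] meant to be already extended by zero; translation
    and Fubini then meet no boundary. *)
Definition convolution g F x := \int[mu]_y (g (x - y) * F y).

Lemma smooth_act_convolution Omega g f :
  smooth_act Omega g f = convolution g (f \_ Omega).
Proof.
apply/funext => x; rewrite /smooth_act /convolution Rintegral_mkcond.
apply: eq_Rintegral => y _; rewrite !patchE.
by case: ifPn => // _; rewrite mulr0.
Qed.

Lemma indic_ballB (x y : 'rV[R]_n) r :
  \1_(ball 0 r) (x - y) = \1_(ball x r) y :> R.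
Proof.
rewrite !indicE; congr (_%:R); congr nat_of_bool.
by apply/idP/idP; rewrite !inE -!ball_normE /= sub0r normrN.
Qed.

Lemma measurable_rV_sub :
  measurable_fun setT (fun z : 'rV[R]_n * 'rV[R]_n => z.1 - z.2).
Proof.
by apply: measurable_rV_add => //; exact: measurable_rV_opp.
Qed.

Lemma measurable_convolution_kernel g F : measurable_fun setT g ->
  measurable_fun setT F ->
  measurable_fun setT (fun z : 'rV[R]_n * 'rV[R]_n => g (z.1 - z.2) * F z.2).
Proof.
move=> mg mF; apply: measurable_funM.
  by apply: (measurableT_comp mg); exact: measurable_rV_sub.
by apply: (measurableT_comp mF); exact: measurable_snd.
Qed.

Lemma measurable_rV_subr g (x : 'rV[R]_n) : measurable_fun setT g ->
  measurable_fun setT (fun y : 'rV[R]_n => g (x - y)).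
Proof.
move=> mg; apply: (measurableT_comp mg).
by apply: measurable_rV_add => //; exact: measurable_rV_opp.
Qed.

Lemma measurable_convolution g F : measurable_fun setT g ->
  measurable_fun setT F ->
  measurable_fun setT (convolution g F).
Proof.
move=> mg mF.
have mI : measurable_fun setT (fun x : 'rV[R]_n =>
  \int[mu]_y (g (x - y) * F y)%:E)%E.
  refine (@measurable_fun_integral _ _ _ _ R (lebesgue_rV n)
    (fun z : 'rV[R]_n * 'rV[R]_n => (g (z.1 - z.2) * F z.2)%:E) _).
  by apply/measurable_EFinP; exact: measurable_convolution_kernel.
exact: (measurableT_comp (@fine_measurable R setT measurableT) mI).
Qed.

(** * Kernels dominated by the indicator of a ball *)

Section bounded_kernel.
Variables (g F : 'rV[R]_n -> R) (p : \bar R) (r M : R).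
Hypotheses (p1 : (1 <= p)%E) (LF : F \in Lfun mu p) (r0 : 0 < r).
Hypotheses (mg : measurable_fun setT g).
Hypotheses (gM : forall x, `|g x| <= M * \1_(ball 0 r) x).

Let mF : measurable_fun setT F. Proof. by have /Lfun_normP[] := LF. Qed.

Let M0 : 0 <= M.
Proof.
have := gM 0; rewrite indicE mem_set ?mulr1; last exact: ballxx.
exact: le_trans.
Qed.

(** The part of [F] that the convolution sees at x. Keeping it in the bound, rather than all of [F],
    leaves a quantity whose p-th power is integrable in x. *)
Let K x y := F y * \1_(ball x r) y.

Let mK x : measurable_fun setT (K x).
Proof. by apply: measurable_funM => //; apply: measurable_indic;
  exact: measurable_rV_ball. Qed.

Let iK x : mu.-integrable setT (EFin \o K x).
Proof.
apply: Lfun_integrable_indic LF _ _ => //; first exact: measurable_rV_ball.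
by rewrite lebesgue_rV_ball// ltry.
Qed.

Let gK x y : `|g (x - y) * F y| <= M * `|K x y|.
Proof.
rewrite /K normrM (le_trans (ler_wpM2r _ (gM _)))// indic_ballB normrM.
by rewrite -!mulrA ler_wpM2l// mulrC ler_wpM2l// ler_norm.
Qed.

Lemma integrable_convolution_kernel x :
  mu.-integrable setT (fun y => (g (x - y) * F y)%:E).
Proof.
have iM : mu.-integrable setT (fun y => (M%:E * (EFin \o K x) y)%E).
  by apply: integrableZl.
apply: (le_integrable measurableT _ _ iM).
- by apply/measurable_EFinP; apply: measurable_funM => //;
  exact: measurable_rV_subr.
- by move=> y _ /=; rewrite lee_fin normrM [leRHS]normrM (ger0_norm M0) -normrM.
Qed.

(** The factor 1 + mu K of the local Hoelder bound, for a sup-norm ball of radius r, whose volume is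
    (2r)^n. *)
Let C := 1 + (r *+ 2) ^+ n.

Let C0 : 0 <= C. Proof. by rewrite addr_ge0// exprn_ge0// mulrn_wge0// ltW. Qed.

Let NK x : ('N[mu]_p[EFin \o K x] <= 'N[mu]_p[EFin \o F])%E.
Proof.
apply: le_Lnorm => // y; rewrite /K normrM indicE.
by case: (_ \in _); rewrite ?normr1 ?mulr1 ?normr0 ?mulr0.
Qed.

Let kernel_le x : (\int[mu]_y `|(g (x - y) * F y)%:E| <=
  (M * C)%:E * 'N[mu]_p[EFin \o K x])%E.
Proof.
apply: (@le_trans _ _ (M%:E * \int[mu]_y `|K x y|%:E)%E).
  rewrite -ge0_integralZl//; last first.
    by apply/measurable_EFinP; exact: measurableT_comp.
  apply: ge0_le_integral => //.
  - do 2 apply: measurableT_comp => //; apply: measurable_funM => //;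
    exact: measurable_rV_subr.
  - by apply: measurable_funeM; apply/measurable_EFinP; exact: measurableT_comp.
  - by move=> y _; rewrite lee_fin gK.
rewrite EFinM -muleA; apply: lee_wpmul2l; first by rewrite lee_fin.
rewrite /C EFinD -(lebesgue_rV_ball x r0); apply: integral_le_Lnorm => //.
- exact: lebesgue_rV_setT_gt0.
- exact: measurable_rV_ball.
- by rewrite [ltLHS]lebesgue_rV_ball// ltry.
- by move=> y xy; rewrite /K indicE memNset// mulr0.
Qed.

(** Uniformity in x is what the exchange of integrals against a test function requires. *)
Lemma convolution_kernel_bounded : exists2 D : R, 0 <= D &
  forall x, (\int[mu]_y `|(g (x - y) * F y)%:E| <= D%:E)%E.
Proof.
have /Lfun_normP[_ NF] := LF.
have NFfin : ('N[mu]_p[EFin \o F])%E \is a fin_num by rewrite ge0_fin_numE//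
  Lnorm_ge0.
exists (M * C * fine ('N[mu]_p[EFin \o F])%E).
  by rewrite !mulr_ge0// fine_ge0// Lnorm_ge0.
move=> x; rewrite EFinM fineK//; apply: (le_trans (kernel_le x)).
by apply: lee_wpmul2l; [rewrite lee_fin mulr_ge0|exact: NK].
Qed.

Let convolution_le_Lnorm_ball x : (`|convolution g F x|%:E <=
  (M * C)%:E * 'N[mu]_p[EFin \o K x])%E.
Proof.
apply: le_trans (kernel_le x).
rewrite /convolution EFin_normr_Rintegral//;
  last exact: integrable_convolution_kernel.
apply: (le_trans (le_abse_integral _ _ _)) => //.
by apply/measurable_EFinP; apply: measurable_funM => //;
  exact: measurable_rV_subr.
Qed.

Lemma convolution_le_Lnorm x :
  (`|convolution g F x|%:E <=
   (M * (1 + (r *+ 2) ^+ n))%:E * 'N[mu]_p[EFin \o F])%E.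
Proof.
apply: (le_trans (convolution_le_Lnorm_ball x)); apply: lee_wpmul2l;
  last exact: NK.
by rewrite lee_fin mulr_ge0.
Qed.

(* Pointwise, |g * F| <= c ||F 1_(ball x r)||_p; for finite p, the integral of
   the p-th power of the right-hand side in x is computed by Tonelli. *)
Lemma convolution_kernel_Lfun : convolution g F \in Lfun mu p.
Proof.
have mcv : measurable_fun setT (convolution g F).
  exact: measurable_convolution.
have cv := convolution_le_Lnorm_ball.
apply/Lfun_normP; split => //.
have /Lfun_normP[_ NF] := LF.
have nk := NK; move: p1 NF cv nk; case: (p) => [q| |]// q1 NF cv nk.
- have LFq : F \in Lfun mu q%:E by apply/Lfun_normP.
  have {}q1 : 1 <= q by rewrite -lee_fin.
  have mH : measurable_fun setT (fun z : 'rV[R]_n * 'rV[R]_n =>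
    (`|K z.1 z.2| `^ q)%:E).
    apply/measurable_EFinP; apply: measurable_norm_powR.
    (* As a function of x - y, the indicator is visibly measurable in both variables jointly. *)
    under eq_fun do rewrite /K -indic_ballB.
    apply: measurable_funM; first by apply: (measurableT_comp mF).
    apply: measurableT_comp; last exact: measurable_rV_sub.
    apply: measurable_indic; exact: measurable_rV_ball.
  have q0 : 0 < q by rewrite (lt_le_trans ltr01).
  rewrite unlock poweR_lty//.
  apply: (@le_lt_trans _ _ (((M * C) `^ q)%:E *
      (\int[mu]_x \int[mu]_y (`|K x y| `^ q)%:E))%E).
    have mI : measurable_fun setT (fun x : 'rV[R]_n =>
      \int[mu]_y (`|K x y| `^ q)%:E)%E.
      exact: (@measurable_fun_integral _ _ _ _ R (lebesgue_rV n) _ mH).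
    rewrite -ge0_integralZl//; last 2 first.
      by move=> x _; apply: integral_ge0 => y _; rewrite lee_fin powR_ge0.
      by rewrite lee_fin powR_ge0.
    apply: ge0_le_integral => //.
    - by move=> x _; exact: poweR_ge0.
    - by apply/measurable_EFinP; exact: measurable_norm_powR.
    - exact: measurable_funeM.
    move=> x _.
    have /(gt0_ler_poweR (ltW q0)) := cv x.
    rewrite !in_itv/= !leey !andbT lee_fin normr_ge0 => /(_ isT).
    rewrite mule_ge0 ?lee_fin ?mulr_ge0 ?Lnorm_ge0// => /(_ isT).
    by rewrite poweRM ?lee_fin ?mulr_ge0 ?Lnorm_ge0// !poweR_EFin powR_Lnorm//
      gt_eqF.
  rewrite (@fubini_tonelli _ _ _ _ R (lebesgue_rV n) (lebesgue_rV n) _ mH) /=;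
    last first.
    by move=> z; rewrite lee_fin powR_ge0.
  (* For fixed y, the x whose ball contains y form the ball around y, of volume (2r)^n whatever y
     is. *)
  have -> : (\int[mu]_y \int[mu]_x (`|K x y| `^ q)%:E =
      \int[mu]_y (((r *+ 2) ^+ n)%:E * (`|F y| `^ q)%:E))%E.
    apply: eq_integral => y _.
    rewrite -(lebesgue_rV_ball y r0) muleC -[X in (_ * lebesgue_rV n X)%E]setIT
      -integral_indic//; last first.
      exact: measurable_rV_ball.
    rewrite -ge0_integralZl//; last first.
      by apply/measurable_EFinP; apply: measurable_indic;
        exact: measurable_rV_ball.
    apply: eq_integral => x _; rewrite /K -EFinM; congr EFin.
    have -> : \1_(ball x r) y = \1_(ball y r) x :> R.
      rewrite !indicE; congr (_%:R); congr nat_of_bool.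
      by apply/idP/idP; rewrite !inE; exact: ball_sym.
    rewrite indicE; case: (_ \in _);
      rewrite ?mulr1// mulr0 normr0 powR0// ?mulr0//.
    by rewrite gt_eqF.
  have iF := Lfun_integrable q1 LFq.
  rewrite ge0_integralZl//; last 2 first.
    by apply/measurable_EFinP; exact: measurable_norm_powR.
    by rewrite lee_fin exprn_ge0// mulrn_wge0// ltW.
  rewrite muleA -EFinM lte_mul_pinfty//;
    last exact: (integrable_lty measurableT iF).
  by rewrite lee_fin mulr_ge0 ?powR_ge0// exprn_ge0// mulrn_wge0// ltW.
(* For p = +oo the pointwise bound is already uniform in x. *)
- rewrite unlock lebesgue_rV_setT_gt0.
  apply: (@le_lt_trans _ _ ((M * C)%:E * 'N[mu]_+oo[EFin \o F])%E).
    apply/ess_supP; apply: nearW => x /=; apply: (le_trans (cv x)).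
    apply: lee_wpmul2l; first by rewrite lee_fin mulr_ge0.
    exact: nk.
  by rewrite lte_mul_pinfty// lee_fin mulr_ge0.
Qed.

End bounded_kernel.

End convolution_theory.

(** * Moving derivatives across a convolution *)

Section weak_derivative_convolution.
Context (R : realType) (n : nat).
Implicit Types (f g F psi : 'rV[R]_n -> R) (l : seq 'I_n).
Implicit Types (Omega : set 'rV[R]_n) (p : \bar R).
Local Notation mu := (lebesgue_rV n : {measure set 'rV[R]_n -> \bar R}).

Lemma smooth_affine f a (s : R) : s != 0 -> smooth f ->
  smooth (fun y => f (a + s *: y)).
Proof.
move=> s0 sf m; have := @Ck_affine R n m f 1 s a s0 (sf m).
by under eq_fun do rewrite mul1r.
Qed.

(** The support is a closed subset of the image of [supp f] under the inverse affine map, hence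
    compact. It serves translates (s = 1) and reflections (s = -1). *)
Lemma Cc_smooth_affine f a (s : R) Omega : s != 0 -> Cc_smooth setT f ->
  (forall y, supp f (a + s *: y) -> Omega y) ->
  Cc_smooth Omega (fun y => f (a + s *: y)).
Proof.
move=> s0 [sf cf _] fO.
have ca : continuous (fun y : 'rV[R]_n => a + s *: y).
  by move=> y; apply: continuousD;
    [exact: cst_continuous|exact: scaler_continuous].
have sub : supp (fun y => f (a + s *: y)) `<=`
    (fun y => a + s *: y) @^-1` supp f.
  have cl : closed ((fun y : 'rV[R]_n => a + s *: y) @^-1` supp f).
    by apply: closed_comp => [y _|]; [exact: ca|exact: closed_closure].
  rewrite [X in _ `<=` X](closure_id _).1//.
  by apply: closure_subset => y fy;
    apply: (@subset_closure _ [set x | f x != 0]).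
split; first exact: smooth_affine.
- apply: (@subclosed_compact _ _ ((fun z => s^-1 *: (z - a)) @` supp f)).
  + exact: closed_closure.
  + apply: continuous_compact => //; apply: continuous_subspaceT => z.
    apply: continuous_comp; last exact: scaler_continuous.
    by apply: continuousB => //; exact: cst_continuous.
  + move=> y /sub sy; exists (a + s *: y) => //.
    by rewrite addrC addKr scalerA mulVf// scale1r.
- by move=> y /sub; exact: fO.
Qed.

Lemma integrable_Cc_smooth_Lfun p Omega psi F : (1 <= p)%E -> F \in Lfun mu p ->
  Cc_smooth Omega psi -> mu.-integrable setT (fun x => (psi x * F x)%:E).
Proof.
move=> p1 LF cpsi; have [r r0 [M psiM]] := Cc_smooth_le_indic cpsi.
have [N psiN] := Cc_smooth_bounded cpsi.
have iF : mu.-integrable setT (fun x => (F x * \1_(ball 0 r) x)%:E).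
  apply: Lfun_integrable_indic LF _ _ => //; first exact: measurable_rV_ball.
  by rewrite [ltLHS]lebesgue_rV_ball// ltry.
have := integrable_bounded_mul (Cc_smooth_measurable cpsi) psiN iF.
congr (mu.-integrable setT _); apply/funext => x; congr EFin.
have := psiM x; rewrite indicE; case: (_ \in _); first by rewrite !mulr1.
by rewrite mulr0 normr_le0 => /eqP ->; rewrite !mul0r.
Qed.

(** Fubini applies because the integral of |g (x - y) F y| in y is at most D for all x, which bounds
    the double integral by D times that of |psi|. *)
Lemma Rintegral_convolution p psi g F : (1 <= p)%E -> F \in Lfun mu p ->
  Cc_smooth setT psi -> Cc_smooth setT g ->
  \int[mu]_x (psi x * convolution g F x) =
    \int[mu]_y (F y * \int[mu]_x (psi x * g (x - y))).
Proof.
move=> p1 LF cpsi cg.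
have /Lfun_normP[mF _] := LF.
have mg := Cc_smooth_measurable cg; have mpsi := Cc_smooth_measurable cpsi.
have [r r0 [M gM]] := Cc_smooth_le_indic cg.
have [Mg gMg] := Cc_smooth_bounded cg.
have [D D0 kD] := convolution_kernel_bounded p1 LF r0 mg gM.
have ik := integrable_convolution_kernel p1 LF r0 mg gM.
have ipsi := Cc_smooth_integrable cpsi.
pose h (z : 'rV[R]_n * 'rV[R]_n) := psi z.1 * (g (z.1 - z.2) * F z.2).
have ipg y : mu.-integrable setT (fun x => (psi x * g (x - y))%:E).
  under eq_fun do rewrite mulrC.
  by apply: (@integrable_bounded_mul _ _ _ _ _ _ Mg) => //;
    exact: measurable_rV_shift.
have mh : measurable_fun setT h.
  apply: measurable_funM; first by apply: (measurableT_comp mpsi).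
  exact: measurable_convolution_kernel.
transitivity (\int[mu]_x \int[mu]_y h (x, y)).
  by apply: eq_Rintegral => x _; rewrite /convolution -RintegralZl//; exact: ik.
have -> : \int[mu]_x \int[mu]_y h (x, y) = \int[mu]_y \int[mu]_x h (x, y).
  apply: (@Rintegral_fubini _ _ _ _ R (lebesgue_rV n) (lebesgue_rV n) h).
  - apply/integrable12ltyP; first exact/measurable_EFinP.
    apply: (@le_lt_trans _ _ (\int[mu]_x (D%:E * `|(psi x)%:E|))%E).
      apply: ge0_le_integral => //.
      + by move=> x _; apply: integral_ge0.
      + apply: (@measurable_fun_integral _ _ _ _ R (lebesgue_rV n) (abse \o
        (EFin \o h))).
        by do 2 apply: measurableT_comp => //.
      + apply: measurable_funeM; apply: measurableT_comp => //;
        exact/measurable_EFinP.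
      + move=> x _; rewrite /h/=.
        under eq_integral do rewrite normrM EFinM.
        rewrite ge0_integralZl//; last first.
          apply/measurable_EFinP; apply: measurableT_comp => //.
          by apply: measurable_funM => //; exact: measurable_rV_subr.
        by rewrite muleC; apply: lee_wpmul2r; [rewrite lee_fin|exact: kD].
    rewrite ge0_integralZl//; last by apply: measurableT_comp => //;
      exact/measurable_EFinP.
    rewrite lte_mul_pinfty//; last by case/integrableP: ipsi.
  - move=> x; rewrite /h/=; under eq_fun do rewrite EFinM.
    by apply: integrableZl.
  - move=> y; rewrite /h/=.
    under eq_fun do rewrite mulrA mulrC EFinM.
    by apply: integrableZl.
apply: eq_Rintegral => y _; rewrite -RintegralZl//; last exact: ipg.
by apply: eq_Rintegral => x _; rewrite /h/= mulrA mulrC.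
Qed.

Lemma Rintegral_convolution_iter_partial p l psi g F : (1 <= p)%E ->
  F \in Lfun mu p ->
  Cc_smooth setT psi -> Cc_smooth setT g ->
  \int[mu]_x (psi x * convolution (iter_partial l g) F x) =
  (-1) ^+ size l * \int[mu]_x (convolution g F x * iter_partial l psi x).
Proof.
move=> p1 LF cpsi cg.
have clg := Cc_smooth_iter_partial l cg;
  have clpsi := Cc_smooth_iter_partial l cpsi.
have [r r0 [M gM]] := Cc_smooth_le_indic cg.
have mg := Cc_smooth_measurable cg.
have /Lfun_normP[mF _] := LF.
have ncv : \int[mu]_x (convolution g F x * iter_partial l psi x) =
   \int[mu]_y (F y * \int[mu]_x (iter_partial l psi x * g (x - y))).
  rewrite -(Rintegral_convolution p1)//.
  by apply: eq_Rintegral => x _; rewrite mulrC.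
rewrite ncv (Rintegral_convolution p1)//.
(* For fixed y the translate of [g] is a test function, so the integration by parts in x leaves [F]
   untouched. *)
have E y : \int[mu]_x (psi x * iter_partial l g (x - y)) =
    (-1) ^+ size l * \int[mu]_x (iter_partial l psi x * g (x - y)).
  have cgy : Cc_smooth setT (fun x => g (- y + 1 *: x)).
    by apply: Cc_smooth_affine; rewrite ?oner_neq0.
  have := iter_integration_by_parts l cgy cpsi.
  rewrite iter_partial_affine ?oner_neq0//; last by case: cg.
  under eq_Rintegral do rewrite expr1n mul1r scale1r addrC mulrC.
  move=> ->; congr (_ * _).
  by apply: eq_Rintegral => x _; rewrite scale1r mulrC [- y + x]addrC.
(* The sign is absorbed into [F], so that the exchange of integrals can be undone with c F in place
   of [F]. *)
set c : R := (-1) ^+ size l.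
have c1 : `|c| = 1 by rewrite normrX normrN1 expr1n.
have LcF : (fun x => c * F x) \in Lfun mu p.
  apply: Lfun_le LF => //; first exact: measurable_funM.
  by move=> x; rewrite normrM c1 mul1r.
transitivity (\int[mu]_y (c * F y * \int[mu]_x (iter_partial l psi x * g (x -
  y)))).
  by apply: eq_Rintegral => y _; rewrite E mulrCA -mulrA.
rewrite -(Rintegral_convolution p1 LcF)// -(Rintegral_convolution p1 LF)//
  -RintegralZl//; last first.
  exact: (integrable_Cc_smooth_Lfun p1 (convolution_kernel_Lfun p1 LF r0 mg gM)
    clpsi).
apply: eq_Rintegral => x _; rewrite mulrCA; congr (_ * _).
rewrite /convolution -RintegralZl//;
  last exact: (integrable_convolution_kernel p1 LF r0 mg gM).
by apply: eq_Rintegral => y _; rewrite mulrCA.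
Qed.

End weak_derivative_convolution.

(** * Weak derivatives *)

Section sobolev_theory.
Context (R : realType) (n : nat).
Implicit Types (f g u F phi psi : 'rV[R]_n -> R).
Implicit Types (Omega : set 'rV[R]_n) (p : \bar R).
Local Notation mu := (lebesgue_rV n : {measure set 'rV[R]_n -> \bar R}).

Lemma Lp_restrict Omega p F : measurable Omega -> (1 <= p)%E ->
  F \in Lfun mu p -> Lp Omega p F.
Proof.
move=> mO p1 LF; have /Lfun_normP[mF _] := LF.
apply: Lfun_le LF => //.
  exact: (measurable_restrictT F mO).1 (measurable_funTS mF).
by move=> x; rewrite patchE; case: ifPn => // _; rewrite normr0.
Qed.

Lemma Lp_L1loc Omega p f : measurable Omega -> (1 <= p)%E ->
  Lp Omega p f -> L1loc Omega f.
Proof.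
move=> mO p1 Lf; have /Lfun_normP[mf _] := Lf.
split; first exact: ((measurable_restrictT f mO).2 mf).
move=> K cK KO; have mK := compact_measurable_rV cK.
apply/integrable_mkcond => //.
have := Lfun_integrable_indic p1 Lf mK (compact_lebesgue_rV_lty cK).
congr (mu.-integrable _ _); apply/funext => x.
rewrite [RHS]patchE indicE; have [xK|xK] := boolP (x \in K);
  last by rewrite mulr0.
by rewrite mulr1 patchE ifT// inE; apply: KO; rewrite inE in xK.
Qed.

Lemma Rintegral_restrictr Omega phi f :
  \int[mu]_(x in Omega) (phi x * f x) = \int[mu]_x (phi x * (f \_ Omega) x).
Proof.
rewrite Rintegral_mkcond; apply: eq_Rintegral => x _.
by rewrite !patchE; case: ifPn => // _; rewrite mulr0.
Qed.

Lemma Rintegral_Cc_smooth Omega phi f : Cc_smooth Omega phi ->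
  \int[mu]_(x in Omega) (phi x * f x) = \int[mu]_x (phi x * f x).
Proof.
move=> [_ _ phiO]; rewrite Rintegral_mkcond; apply: eq_Rintegral => x _.
rewrite patchE; case: ifPn => // /negP; rewrite inE => xO.
by rewrite supp0 ?mul0r// => /phiO.
Qed.

Lemma Cc_smooth_partials Omega alpha phi :
  Cc_smooth Omega phi -> Cc_smooth Omega (partials alpha phi).
Proof. by rewrite partialsE; exact: Cc_smooth_iter_partial. Qed.

Lemma Cc_smoothT Omega phi : Cc_smooth Omega phi -> Cc_smooth setT phi.
Proof. by move=> []. Qed.

Lemma convolution_Lfun p g F : (1 <= p)%E -> F \in Lfun mu p ->
  Cc_smooth setT g ->
  convolution g F \in Lfun mu p.
Proof.
move=> p1 LF cg; have [r r0 [M gM]] := Cc_smooth_le_indic cg.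
exact: convolution_kernel_Lfun p1 LF r0 (Cc_smooth_measurable cg) gM.
Qed.

(** A test function on Omega vanishes outside it, so both integrals extend to R^n and the identity
    there applies. It serves both for the given open set and for [act_domain]. *)
Lemma weak_deriv_convolution Omega p alpha g F : measurable Omega ->
  (1 <= p)%E -> F \in Lfun mu p -> Cc_smooth setT g ->
  weak_deriv Omega alpha (convolution g F) (convolution (partials alpha g) F).
Proof.
move=> mO p1 LF cg; split.
  apply: (Lp_L1loc mO p1); apply: Lp_restrict => //.
  by apply: convolution_Lfun => //; exact: Cc_smooth_partials.
move=> psi cpsi; rewrite Rintegral_Cc_smooth//.
under [in RHS]eq_Rintegral do rewrite mulrC.
rewrite (Rintegral_Cc_smooth _ (Cc_smooth_partials alpha cpsi)).
rewrite !partialsE (Rintegral_convolution_iter_partial _ p1)//;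
  last exact: Cc_smoothT cpsi.
rewrite size_midx_seq; congr (_ * _).
by apply: eq_Rintegral => x _; rewrite mulrC.
Qed.

(* The pairing with phi is the value at 0 of the convolution with
   y |-> phi (- y). *)
Lemma Lp_cvg_Rintegral Omega p phi (v_ : nat -> 'rV[R]_n -> R) v : (1 <= p)%E ->
  Cc_smooth setT phi -> (forall j, Lp Omega p (v_ j)) -> Lp Omega p v ->
  Lp_cvg Omega p v_ v ->
  \int[mu]_(x in Omega) (phi x * v_ j x) @[j --> \oo] -->
    \int[mu]_(x in Omega) (phi x * v x).
Proof.
move=> p1 cphi Lv_ Lv vcvg.
pose g y := phi (0 + (-1) *: y).
have cg : Cc_smooth setT g by apply: Cc_smooth_affine;
  rewrite ?oppr_eq0 ?oner_eq0.
have [r r0 [M gM]] := Cc_smooth_le_indic cg.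
pose W j := (v_ j \- v)%R \_ Omega.
have WE j : W j = (v_ j \_ Omega \- v \_ Omega)%R.
  by apply/funext => x; rewrite /W /= !patchE; case: ifPn => // _;
    rewrite subr0.
have LW j : W j \in Lfun mu p.
  have [_ LD] := Lfun_addr_closed mu p1;
    have LN := @Lfun_oppr_closed _ _ _ mu p.
  by rewrite WE; apply: LD; [exact: Lv_|apply: LN; exact: Lv].
pose c := M * (1 + (r *+ 2) ^+ n).
have bound j : (`|\int[mu]_(x in Omega) (phi x * v_ j x) - \int[mu]_(x in
  Omega) (phi x * v x)|%:E
    <= c%:E * 'N[mu]_p[EFin \o W j])%E.
  rewrite (Rintegral_restrictr Omega phi (v_ j)) (Rintegral_restrictr Omega phi
    v) -RintegralB//; last 2 first.
    exact: integrable_Cc_smooth_Lfun p1 (Lv_ j) cphi.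
    exact: integrable_Cc_smooth_Lfun p1 Lv cphi.
  apply: le_trans (convolution_le_Lnorm p1 (LW j) r0 (Cc_smooth_measurable cg)
    gM 0).
  rewrite le_eqVlt; apply/orP; left; apply/eqP; congr (`| _ |%:E).
  apply: eq_Rintegral => y _; rewrite /g add0r sub0r scaleN1r opprK WE/=.
  by rewrite mulrBr.
apply/subr_cvg0; apply: norm_cvg0.
have : (`|\int[mu]_(x in Omega) (phi x * v_ j x) - \int[mu]_(x in Omega) (phi x
  * v x)|%:E)%E
    @[j --> \oo] --> 0%:E.
  apply: (@squeeze_cvge _ _ _ _ (cst 0%E) _ (fun j =>
    c%:E * 'N[mu]_p[EFin \o W j])%E).
  - by apply: nearW => j; rewrite lee_fin normr_ge0 bound.
  - exact: cvg_cst.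
  - have cfin : c%:E \is a fin_num by [].
    by have := cvgeZl cfin vcvg; rewrite mule0; exact.
by move=> H; exact: (fine_cvg H).
Qed.

(** The condition at each z of the support persists for points near (z, x), and compactness makes
    the neighbourhood of x uniform in z. Openness gives measurability of the domain. *)
Lemma open_act_domain Omega phi : open Omega -> compact (supp phi) ->
  open (act_domain Omega phi).
Proof.
move=> oO cphi; rewrite openE => x [Ox Sx]; rewrite /interior.
have := (compact_near_coveringP _).1 cphi _ (nbhs x)
  (fun x' z => Omega (x' - z)) _.
move=> /(_ _) H.
have N : \forall x' \near x, supp phi `<=` (fun z => Omega (x' - z)).
  apply: H => z /Sx Oxz.
  have cB : {for (z, x), continuous (fun w : 'rV[R]_n * 'rV[R]_n => w.2 - w.1)}.
    by apply: (@continuousB _ _ _ snd fst); [exact: cvg_snd|exact: cvg_fst].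
  have := cB Omega; apply; exact: open_nbhs_nbhs.
near=> x'; split; first by near: x'; exact: open_nbhs_nbhs.
by near: x'.
Unshelve. all: by end_near. Qed.

Lemma partials_reflect alpha phi (x : 'rV[R]_n) : smooth phi ->
  partials alpha (fun y => phi (x - y)) =
  (fun y => (-1) ^+ midx_size alpha * partials alpha phi (x - y)).
Proof.
move=> sphi; rewrite !partialsE -size_midx_seq.
have N1 : -1 != 0 :> R by rewrite oppr_eq0 oner_eq0.
have -> : (fun y => phi (x - y)) = (fun y => phi (x + (-1) *: y)).
  by apply/funext => y; rewrite scaleN1r.
rewrite [LHS](iter_partial_affine (midx_seq alpha) x N1 sphi).
by apply/funext => y; rewrite scaleN1r.
Qed.

(** Two signs (-1)^|alpha| cancel: one from the definition of the weak derivative, one from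
    differentiating the reflection y |-> phi (x - y). *)
Lemma smooth_act_weak_deriv Omega p alpha phi f u x : (1 <= p)%E ->
  Cc_smooth setT phi -> Lp Omega p f -> weak_deriv Omega alpha f u ->
  act_domain Omega phi x ->
  smooth_act Omega phi u x = convolution (partials alpha phi) (f \_ Omega) x.
Proof.
move=> p1 cphi Lf [_ Hu] [Ox Sx].
have cpx : Cc_smooth Omega (fun y => phi (x - y)).
  have N1 : -1 != 0 :> R by rewrite oppr_eq0 oner_eq0.
  have -> : (fun y => phi (x - y)) = (fun y => phi (x + (-1) *: y)).
    by apply/funext => y; rewrite scaleN1r.
  apply: Cc_smooth_affine => // y; rewrite scaleN1r => /Sx.
  by rewrite opprB addrC subrK.
rewrite /smooth_act Hu// partials_reflect; last by case: cphi.
set a : R := (-1) ^+ midx_size alpha.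
have cap := Cc_smooth_partials alpha cphi.
have [r r0 [M gM]] := Cc_smooth_le_indic cap.
have ik := integrable_convolution_kernel p1 Lf r0 (Cc_smooth_measurable cap) gM
  x.
transitivity (a * \int[mu]_y (a * (partials alpha phi (x - y) * (f \_ Omega)
  y))).
  congr (_ * _).
  have := Rintegral_restrictr Omega (fun y => a * partials alpha phi (x - y)) f.
  under eq_Rintegral do rewrite mulrC.
  by move=> ->; under eq_Rintegral do rewrite -mulrA.
by rewrite RintegralZl// mulrA -expr2 sqrr_sign mul1r.
Qed.

End sobolev_theory.

Theorem theorem2p7 (R : realType) (n k : nat) (Omega : set 'rV[R]_n)
    (p : \bar R) (alpha : 'I_n -> nat) :
  open Omega -> (1 <= p)%E -> (midx_size alpha <= k)%N ->
  [/\ forall f, sobolev Omega k p f ->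
        exists u, weak_diff Omega p alpha f u,
      closed_op Omega p (weak_diff Omega p alpha)
    & equivariant Omega p alpha (sobolev Omega k p)].
Proof.
move=> oO p1 ak; have mO := open_measurable_rV oO; split.
- by move=> f [Lf /(_ alpha ak)[u [du Lu]]]; exists u.
- move=> f_ u_ f u D Lf Lu fcvg ucvg; split => //; split;
  first exact: Lp_L1loc Lu.
  move=> phi cphi; have cphiT := Cc_smoothT cphi.
  have cap := Cc_smooth_partials alpha cphiT.
  have Lf_ j : Lp Omega p (f_ j) by have [] := D j.
  have Lu_ j : Lp Omega p (u_ j) by have [] := D j.
  have A := Lp_cvg_Rintegral p1 cphiT Lu_ Lu ucvg.
  have B := Lp_cvg_Rintegral p1 cap Lf_ Lf fcvg.
  under [in RHS]eq_Rintegral do rewrite mulrC.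
  set c : R := (-1) ^+ midx_size alpha.
  have E : (fun j => \int[lebesgue_rV n]_(x in Omega) (phi x * u_ j x)) =
      (fun j => c * \int[lebesgue_rV n]_(x in Omega)
        (partials alpha phi x * f_ j x)).
    apply/funext => j; have [_ _ [_ ->//]] := D j; congr (_ * _).
    by apply: eq_Rintegral => x _; rewrite mulrC.
  (* The two sides of the weak identity for [f] and [u] are limits of one and the same sequence. *)
  rewrite E in A; apply: (cvg_unique _ A) => //.
  by apply: cvgMr; exact: B.
- move=> phi net e e0 f u [Lf Wf] [_ Lu du].
  have cphi := net_Cc_smooth net e0.
  have [_ cs _] := cphi.
  have mA := open_measurable_rV (open_act_domain oO cs).
  have Lact v : Lp Omega p v ->
      convolution (phi e) (v \_ Omega) \in Lfun (lebesgue_rV n) p.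
    by move=> Lv; exact: convolution_Lfun.
  rewrite !smooth_act_convolution; split.
    split; first by apply: Lp_restrict => //; exact: Lact.
    (* All derivatives fall on [phi e], so each weak derivative is again a convolution of [f] with a
       test function and lies in L^p by the same bound. *)
    move=> beta _; exists (convolution (partials beta (phi e)) (f \_ Omega));
      split.
      exact: weak_deriv_convolution p1 Lf cphi.
    apply: Lp_restrict => //; apply: convolution_Lfun => //;
      exact: Cc_smooth_partials.
  split; [by apply: Lp_restrict => //; exact: Lact..|].
  split; first by apply: (Lp_L1loc mA p1); apply: Lp_restrict => //;
    exact: Lact.
  move=> psi cpsi.
  have [_ H] := weak_deriv_convolution alpha mA p1 Lf cphi.
  apply: etrans (H psi cpsi).
  (* The integral runs over [act_domain], exactly where the two convolutions agree pointwise. *)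
  apply: eq_Rintegral => x /set_mem xA; congr (_ * _).
  by rewrite -smooth_act_convolution (smooth_act_weak_deriv p1 cphi Lf du).
Qed.
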